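(* Let $\Lambda$ be a finite set, let $A$ be an invertible complex $\Lambda\times\Lambda$ matrix such that $C=A^{-1}$ has positive Hermitian part, and let $a,b\in\Lambda$. Then $$\sum_{\omega\in\mathcal{S}_{a,b}(\Lambda)}C^\omega=\int e^{-S_A}\,\bar\varphi_a\varphi_b\prod_{x\in\Lambda,\;x\ne a,b}(1+\tau_x).$$
   Context: Walks: $\mathcal{S}_{a,b}(\Lambda)$ is the set of sequences $\omega=(a,x_1,\dots,x_{n-1},b)$ with $n\ge1$ arbitrary and $x_1,\dots,x_{n-1}$ distinct elements of $\Lambda\setminus\{a,b\}$. For such $\omega=(\omega(0),\dots,\omega(n))$, $C^\omega=\prod_{i=1}^{n}C_{\omega(i-1),\omega(i)}$. Positive Hermitian part: $\sum_{x,y\in\Lambda}\varphi_x(C_{xy}+\overline{C_{yx}})\bar\varphi_y>0$ for all nonzero $\varphi\in\mathbb{C}^\Lambda$. Differential forms: let $M=|\Lambda|$ and let $(u_x,v_x)_{x\in\Lambda}$ be real coordinates on $\mathbb{R}^{2M}$. Set $\varphi_x=u_x+iv_x$, $\bar\varphi_x=u_x-iv_x$, $d\varphi_x=du_x+i\,dv_x$, $d\bar\varphi_x=du_x-i\,dv_x$. Differentials are multiplied with the anticommutative wedge product, omitted from the notation. With a fixed choice of the complex square root, set $\psi_x=(2\pi i)^{-1/2}d\varphi_x$ and $\bar\psi_x=(2\pi i)^{-1/2}d\bar\varphi_x$. Define the differential forms $$S_A=\sum_{x,y\in\Lambda}\varphi_xA_{xy}\bar\varphi_y+\sum_{x,y\in\Lambda}\psi_xA_{xy}\bar\psi_y,\qquad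 \tau_x=\varphi_x\bar\varphi_x+\psi_x\bar\psi_x .$$ Functions of forms: a smooth function of a collection of forms of even degree is defined by its (finite) Taylor expansion about the degree-zero parts; in particular $$e^{-S_A}=e^{-\varphi A\bar\varphi}\sum_{n=0}^{M}\frac{(-1)^n}{n!}(\psi A\bar\psi)^n,$$ where $\varphi A\bar\varphi=\sum_{x,y}\varphi_xA_{xy}\bar\varphi_y$ and $\psi A\bar\psi=\sum_{x,y}\psi_xA_{xy}\bar\psi_y$. Integration: enumerate $\Lambda=\{1,\dots,M\}$. If the term of degree $2M$ of a form $F$ is $f(u,v)\,du_1dv_1\cdots du_Mdv_M$, then $\int F=\int_{\mathbb{R}^{2M}}f(u,v)\,du_1dv_1\cdots du_Mdv_M$ (Lebesgue integral); if $F$ has no term of degree $2M$, its integral is $0$. *)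

(* Defs.v *)
From HB Require Import structures.
From mathcomp Require Import all_boot all_order all_algebra.
From mathcomp Require Import all_classical all_reals all_analysis.
From mathcomp Require Import complex.

Set Implicit Arguments.
Unset Strict Implicit.
Unset Printing Implicit Defensive.

Import Order.TTheory GRing.Theory Num.Theory.

Local Open Scope classical_set_scope.
Local Open Scope complex_scope.
Local Open Scope ring_scope.

(** * Exterior algebra *)

(* The exterior algebra over K on n generators e_0, ..., e_(n-1): the
   coefficient at S = {i_1 < ... < i_k} is that of e_(i_1) ... e_(i_k). *)
Definition extalg (K : comNzRingType) (n : nat) := {ffun {set 'I_n} -> K^o}.

HB.instance Definition _ K n := GRing.Lmodule.copy (extalg K n)
  {ffun {set 'I_n} -> K^o}.

Section ExteriorAlgebra.
Variables (K : comNzRingType) (n : nat).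
Implicit Types (S T U V W : {set 'I_n}) (f g h : extalg K n).

(* Number of transpositions needed to sort e_S e_T, for S, T disjoint. *)
Definition inversions S T : nat := (\sum_(i in S) \sum_(j in T) (j < i))%N.

Definition ext_mul f g : extalg K n :=
  [ffun S : {set 'I_n} => \sum_(T : {set 'I_n} | T \subset S)
    (-1) ^+ inversions T (S :\: T) * ((f T : K) * (g (S :\: T) : K))].

Definition ext_one : extalg K n := [ffun S : {set 'I_n} => (S == finset.set0)%:R].

Lemma inversionsUl S T U : [disjoint S & T]%bool ->
  inversions (S :|: T) U = (inversions S U + inversions T U)%N.
Proof. by move=> dST; rewrite /inversions -bigU //; apply: eq_bigl => i; rewrite !inE. Qed.

Lemma inversionsUr S T U : [disjoint T & U]%bool ->
  inversions S (T :|: U) = (inversions S T + inversions S U)%N.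
Proof.
move=> dTU; rewrite /inversions -big_split; apply: eq_bigr => i _.
by rewrite -bigU //; apply: eq_bigl => j; rewrite !inE.
Qed.

Lemma inversions0l S : inversions finset.set0 S = 0%N.
Proof. by rewrite /inversions big_set0. Qed.

Lemma inversions0r S : inversions S finset.set0 = 0%N.
Proof. by rewrite /inversions big1 // => i _; rewrite big_set0. Qed.

Lemma ext_mulA : associative ext_mul.
Proof.
move=> f g h; apply/ffunP => S; rewrite !ffunE.
transitivity (\sum_(U : {set 'I_n} | U \subset S)
    \sum_(V : {set 'I_n} | V \subset S :\: U)
    (-1) ^+ (inversions U (S :\: U) + inversions V ((S :\: U) :\: V)) *
      ((f U : K) * (g V : K) * (h ((S :\: U) :\: V) : K))).
  apply: eq_bigr => U sUS; rewrite ffunE !mulr_sumr; apply: eq_bigr => V sV.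
  by rewrite exprD -!mulrA; congr (_ * _); rewrite mulrCA.
have -> : \sum_(T : {set 'I_n} | T \subset S)
    (-1) ^+ inversions T (S :\: T) * ((ext_mul f g T : K) * (h (S :\: T) : K))
  = \sum_(T : {set 'I_n} | T \subset S) \sum_(U : {set 'I_n} | U \subset T)
    (-1) ^+ (inversions T (S :\: T) + inversions U (T :\: U)) *
      ((f U : K) * (g (T :\: U) : K) * (h (S :\: T) : K)).
  apply: eq_bigr => T sTS; rewrite ffunE mulr_suml !mulr_sumr.
  by apply: eq_bigr => U sUT; rewrite exprD -!mulrA.
rewrite [RHS](exchange_big_dep (fun U => U \subset S)) /=; last first.
  by move=> T U sTS sUT; apply: fintype.subset_trans sTS.
apply: eq_bigr => U sUS; symmetry.
rewrite (reindex_onto (fun V => U :|: V) (fun T => T :\: U)) /=; last first.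
  move=> T /andP[sTS sUT]; apply/setP => x; rewrite !inE.
  by case xU: (x \in U) => //=; rewrite (fintype.subsetP sUT).
have sVE V : (U :|: V \subset S) && (U \subset U :|: V) &&
    ((U :|: V) :\: U == V) = (V \subset S :\: U).
  rewrite finset.subUset sUS finset.subsetUl finset.subsetD /= andbT.
  rewrite finset.setDUl finset.setDv finset.set0U; congr (_ && _).
  exact: (sameP eqP finset.setDidPl).
apply: eq_big => [V|V]; rewrite sVE // => sV.
have dVU : [disjoint V & U]%bool.
  by move: sV; rewrite finset.subsetD => /andP[].
have VUE : (U :|: V) :\: U = V.
  by rewrite finset.setDUl finset.setDv finset.set0U; apply/finset.setDidPl.
rewrite VUE -finset.setDDl; congr ((-1) ^+ _ * _).
set W := S :\: U :\: V.
have -> : S :\: U = V :|: W.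
  apply/setP => x; rewrite /W !inE; case xV: (x \in V) => //=.
  by move/fintype.subsetP: sV => /(_ _ xV); rewrite !inE.
rewrite inversionsUl 1?disjoint_sym // inversionsUr; first by rewrite addnC addnA.
by rewrite /W finset.disjoints_subset; apply/fintype.subsetP => x; rewrite !inE => ->.
Qed.

Lemma ext_mul1l : left_id ext_one ext_mul.
Proof.
move=> f; apply/ffunP => S; rewrite ffunE.
rewrite (bigD1 finset.set0) ?finset.sub0set //= big1 => [|T /andP[_ T0]].
  by rewrite ffunE eqxx mul1r inversions0l mul1r finset.setD0 addr0.
by rewrite ffunE (negPf T0) mul0r mulr0.
Qed.

Lemma ext_mul1r : right_id ext_one ext_mul.
Proof.
move=> f; apply/ffunP => S; rewrite ffunE (bigD1 S) //= big1 => [|T /andP[sTS TS]].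
  by rewrite ffunE finset.setDv eqxx mulr1 inversions0r mul1r addr0.
rewrite ffunE finset.setD_eq0 (_ : (S \subset T) = false) ?mulr0 //.
by apply: contraNF TS => sST; rewrite finset.eqEsubset sTS.
Qed.

Lemma ext_mulDl : left_distributive ext_mul +%R.
Proof.
move=> f g h; apply/ffunP => S; rewrite !ffunE -big_split; apply: eq_bigr => T _.
by rewrite ffunE mulrDl mulrDr.
Qed.

Lemma ext_mulDr : right_distributive ext_mul +%R.
Proof.
move=> f g h; apply/ffunP => S; rewrite !ffunE -big_split; apply: eq_bigr => T _.
by rewrite ffunE mulrDr mulrDr.
Qed.

Lemma ext_one_neq0 : ext_one != 0.
Proof.
by apply/eqP => /ffunP/(_ finset.set0); rewrite !ffunE eqxx => /eqP; rewrite oner_eq0.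
Qed.

HB.instance Definition _ := GRing.Zmodule_isNzRing.Build (extalg K n)
  ext_mulA ext_mul1l ext_mul1r ext_mulDl ext_mulDr ext_one_neq0.

Lemma ext_scaleAl (a : K) f g : a *: (f * g) = (a *: f) * g.
Proof.
apply/ffunP => S; rewrite !ffunE scaler_sumr; apply: eq_bigr => T _.
by rewrite ffunE /GRing.scale /= mulrCA !mulrA.
Qed.

Lemma ext_scaleAr (a : K) f g : a *: (f * g) = f * (a *: g).
Proof.
apply/ffunP => S; rewrite !ffunE scaler_sumr; apply: eq_bigr => T _.
by rewrite ffunE /GRing.scale /= mulrCA [in RHS](mulrCA (f T : K)).
Qed.

HB.instance Definition _ :=
  GRing.Lmodule_isLalgebra.Build K (extalg K n) ext_scaleAl.
HB.instance Definition _ :=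
  GRing.Lalgebra_isAlgebra.Build K (extalg K n) ext_scaleAr.

Definition ext_gen (i : 'I_n) : extalg K n :=
  [ffun S : {set 'I_n} => (S == [set i]%SET)%:R].

Lemma ext_genM i f S : (ext_gen i * f) S =
  (if i \in S then (-1) ^+ inversions [set i] (S :\ i) * (f (S :\ i) : K)
   else 0).
Proof.
rewrite ffunE; case: ifPn => iS.
  rewrite (bigD1 [set i]%SET) ?finset.sub1set //= big1 => [|T /andP[_ Ti]].
    by rewrite ffunE eqxx mul1r addr0.
  by rewrite ffunE (negPf Ti) mul0r mulr0.
apply: big1 => T sTS; rewrite ffunE (_ : (T == _) = false) ?mul0r ?mulr0 //.
by apply: contraNF iS => /eqP Ti; rewrite -finset.sub1set -Ti.
Qed.

Lemma ext_gen_sq i : ext_gen i * ext_gen i = 0.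
Proof.
apply/ffunP => S; rewrite ext_genM !ffunE; case: ifP => // _.
rewrite (_ : (_ == _) = false) ?mulr0 //; apply/negbTE/eqP => /setP/(_ i).
by rewrite !inE eqxx.
Qed.

Lemma ext_gen_anticomm i j : ext_gen i * ext_gen j = - (ext_gen j * ext_gen i).
Proof.
have [->|ij] := eqVneq i j; first by rewrite ext_gen_sq oppr0.
have coefE k l S : k != l -> (ext_gen k * ext_gen l) S =
    ((S == [set k; l]%SET)%:R * (-1) ^+ (l < k)%N : K).
  move=> kl; rewrite ext_genM ffunE; have [->|Skl] := eqVneq S _.
    have -> : ([set k; l] :\ k = [set l])%SET.
      apply/setP => x; rewrite !inE; case: eqVneq => //= ->.
      by rewrite (negPf kl).
    by rewrite !inE !eqxx /= mulr1 mul1r /inversions !finset.big_set1.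
  rewrite mul0r; case: ifPn => // kS; rewrite (_ : (_ == _) = false) ?mulr0 //.
  by apply: contraNF Skl => /eqP Skl; rewrite -(finset.setD1K kS) Skl.
have ji : j != i by rewrite eq_sym.
apply/ffunP => S; rewrite [RHS]ffunE !coefE // finset.setUC.
case: (ltngtP i j) => [_|_|/val_inj ijE]; last by rewrite ijE eqxx in ij.
  by rewrite expr0 expr1 mulrN1 opprK mulr1.
by rewrite expr0 expr1 mulrN1 mulr1.
Qed.

Lemma prod_ext_gen :
  \prod_(i < n) ext_gen i = [ffun S : {set 'I_n} => (S == [set: 'I_n]%SET)%:R].
Proof.
suff prodE (s : seq 'I_n) : sorted (fun i j : 'I_n => (i < j)%N) s ->
    \prod_(i <- s) ext_gen i
    = [ffun S : {set 'I_n} => (S == [set i in s]%SET)%:R].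
  rewrite prodE; last first.
    have : sorted ltn (map val (index_enum 'I_n)).
      by rewrite /index_enum unlock -enumT val_enum_ord iota_ltn_sorted.
    by rewrite sorted_map.
  apply/ffunP => S; rewrite !ffunE; congr (_ == _)%:R.
  by apply/setP => i; rewrite !inE mem_index_enum.
elim: s => [|i s IHs] /= sP.
  rewrite big_nil; apply/ffunP => S; rewrite !ffunE; congr (_ == _)%:R.
rewrite big_cons IHs; last exact: path_sorted sP.
have lt_i : all (fun j : 'I_n => (i < j)%N) s.
  by apply: order_path_min sP => a b c; apply: ltn_trans.
have i_s : i \notin s.
  by apply/negP => /(allP lt_i); rewrite ltnn.
apply/ffunP => S; rewrite ext_genM !ffunE.
have -> : [set j in i :: s]%SET = (i |: [set j in s])%SET.
  by apply/setP => j; rewrite !inE.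
have [->|SP] := eqVneq S _.
  rewrite !inE !eqxx /= finset.setU1K ?inE // eqxx mulr1 /inversions.
  rewrite finset.big_set1 big1 // => j; rewrite inE => /(allP lt_i) /ltnW ij.
  by rewrite ltnNge ij.
case: ifPn => // iS; rewrite (_ : (_ == _) = false) ?mulr0 //.
by apply: contraNF SP => /eqP SP; rewrite -(finset.setD1K iS) SP.
Qed.

End ExteriorAlgebra.

Section LebesgueTuple.
Variable R : realType.
Local Open Scope classical_set_scope.

Definition cons_pair n (p : measurableTypeR R * n.-tuple (measurableTypeR R)) :
  n.+1.-tuple (measurableTypeR R) := [the _.-tuple _ of p.1 :: p.2].

Lemma measurable_cons_pair n : measurable_fun setT (@cons_pair n).
Proof. exact: measurable_cons. Qed.

Section Step.
Variables (n : nat)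
  (mu : {sigma_finite_measure set (n.-tuple (measurableTypeR R)) -> \bar R}).

Definition cons_measure :=
  pushforward (@lebesgue_measure R \x mu)%E (@cons_pair n).

Let pushforward_cons : {measure set (n.+1.-tuple (measurableTypeR R)) -> \bar R} :=
  measure_function_pushforward__canonical__measure_function_Measure
    (@lebesgue_measure R \x mu)%E (@measurable_cons_pair n).

Lemma cons_measure0 : cons_measure set0 = 0%E.
Proof. exact: (measure0 pushforward_cons). Qed.

Lemma cons_measure_ge0 A : (0 <= cons_measure A)%E.
Proof. exact: (measure_ge0 pushforward_cons). Qed.

Lemma cons_measure_sigma_additive : semi_sigma_additive cons_measure.
Proof. exact: (@measure_semi_sigma_additive _ _ _ pushforward_cons). Qed.

HB.instance Definition _ := isMeasure.Build _ _ _ cons_measure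
  cons_measure0 cons_measure_ge0 cons_measure_sigma_additive.

Lemma cons_measure_sigma_finite : sigma_finite setT cons_measure.
Proof.
have /sigma_finiteP[F [TF ndF Foo]] := sigma_finiteT (@lebesgue_measure R).
have /sigma_finiteP[G [TG ndG Goo]] := sigma_finiteT mu.
pose uncons (t : n.+1.-tuple (measurableTypeR R)) := (thead t, [tuple of behead t]).
have muncons : measurable_fun setT uncons.
  apply/measurable_fun_pairP; split; last exact: measurable_behead.
  exact: measurable_tnth.
have unconsK p : uncons (cons_pair p) = p.
  by case: p => x t; rewrite /uncons /cons_pair /= theadE; congr pair; apply/val_inj.
exists (fun k => uncons @^-1` (F k `*` G k)).
  rewrite -preimage_bigcup -(preimage_setT uncons) -setXTT TF TG; congr (_ @^-1` _).
  apply/seteqP; split => [[x y] [/= [k _ Fkx] [l _ Gly]]|[x y] [k _ [/= ? ?]]].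
    exists (maxn k l) => //; split => /=.
      by move: x Fkx; exact/subsetPset/ndF/leq_maxl.
    by move: y Gly; exact/subsetPset/ndG/leq_maxr.
  by split; exists k.
move=> k; have [mF Fk] := Foo k; have [mG Gk] := Goo k.
split; first by rewrite -[X in measurable X]setTI; apply: muncons => //; exact: measurableX.
rewrite /cons_measure /pushforward -comp_preimage.
rewrite (_ : _ \o _ = id); last by apply/funext => p; exact: unconsK.
by rewrite preimage_id product_measure1E // lte_mul_pinfty// ge0_fin_numE.
Qed.

HB.instance Definition _ := Measure_isSigmaFinite.Build _ _ _ cons_measure
  cons_measure_sigma_finite.

End Step.

Fixpoint lebesgue_tuple n :
    {sigma_finite_measure set (n.-tuple (measurableTypeR R)) -> \bar R} :=
  if n is n'.+1 then cons_measure (lebesgue_tuple n') else dirac [tuple].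

Lemma lebesgue_tuple_box n (A : 'I_n -> set (measurableTypeR R)) :
  (forall i, measurable (A i)) ->
  lebesgue_tuple n [set t | forall i, A i (tnth t i)] =
  (\prod_(i < n) lebesgue_measure (A i))%E.
Proof.
elim: n A => [|n IHn] A mA.
  rewrite big_ord0 /= diracE mem_set //; by case.
have mbox : measurable
    [set t : n.-tuple (measurableTypeR R) | forall i, A (lift ord0 i) (tnth t i)].
  rewrite (_ : mkset _ =
      \bigcap_(i in [set: 'I_n]) ((fun t => tnth t i) @^-1` A (lift ord0 i))).
    apply: fin_bigcap_measurable => [|i _]; first exact: finite_finset.
    by rewrite -[X in measurable X]setTI; exact: measurable_tnth.
  by apply/seteqP; split => t /= tA; [move=> i _|move=> i]; exact: tA.
rewrite big_ord_recl -IHn //= -product_measure1E //.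
rewrite [LHS]/cons_measure /pushforward; congr (product_measure1 _ _ _).
apply/seteqP; split => -[x t] /=.
  move=> tA; split; first by have := tA ord0; rewrite tnth0.
  by move=> i; have := tA (lift ord0 i); rewrite tnthS.
move=> [xA tA] i; case: (unliftP ord0 i) => [j ->|->]; first by rewrite tnthS.
by rewrite tnth0.
Qed.

End LebesgueTuple.

Section Walks.
Variable L : finType.
Local Open Scope classical_set_scope.

Definition walks (a b : L) : set (seq L) :=
  [set w | exists s : seq L, [/\ w = a :: rcons s b, uniq s
    & forall x, x \in s -> x != a /\ x != b]].

Lemma finite_walks (a b : L) : finite_set (walks a b).
Proof.
apply: (@sub_finite_set _ _
    ((fun s : #|L|.-bseq L => a :: rcons s b) @` setT)); last first.
  by apply: finite_image; exact: finite_finset.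
move=> _ [s [-> s_uniq _]].
have s_le : (size s <= #|L|)%N.
  by rewrite -(card_uniqP s_uniq) max_card.
by exists (Bseq s_le).
Qed.

Definition entry (K : Type) (A : 'M[K]_#|L|) (x y : L) : K :=
  A (enum_rank x) (enum_rank y).

(* The product of C over the pairs of consecutive vertices of w. *)
Definition walk_weight (K : pzSemiRingType) (C : 'M[K]_#|L|) (w : seq L) : K :=
  \prod_(e <- zip w (behead w)) entry C e.1 e.2.

End Walks.

(* The strict order of R[i] compares real parts of numbers with equal imaginary
   parts, so 0 < z means that z is a positive real. *)
Definition positive_hermitian_part (R : realType) n (C : 'M[R[i]]_n) : Prop :=
  forall phi : 'rV[R[i]]_n, phi != 0 ->
    0 < \sum_x \sum_y phi 0 x * (C x y + (C y x)^*) * (phi 0 y)^*.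

Definition expC (R : realType) (z : R[i]) : R[i] :=
  (expR (complex.Re z))%:C * (cos (complex.Im z) +i* sin (complex.Im z)).

Section DifferentialForms.
Variables (R : realType) (L : finType).

(* With L enumerated by enum_rank, the coordinates of R^(2 #|L|) are ordered as
   u_0, v_0, u_1, v_1, ...: the index is 2 i for u_i and 2 i + 1 for v_i. *)
Lemma uv_index_subproof (x : L) (c : bool) : ((enum_rank x).*2 + c < #|L|.*2)%N.
Proof.
have := ltn_ord (enum_rank x); rewrite -leq_double doubleS => /(leq_trans _); apply.
by case: c; rewrite ?addn1 ?addn0.
Qed.

Definition uv_index (x : L) (c : bool) : 'I_#|L|.*2 :=
  Ordinal (uv_index_subproof x c).

Local Notation point := (#|L|.*2.-tuple (measurableTypeR R)).

(* A form is the function giving its value, in the exterior algebra on the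
   differentials of the coordinates, at each point; forms are a ring (with the
   wedge product) and a module over R[i] for the pointwise operations. *)
Local Notation form := (point -> extalg R[i] #|L|.*2).

Definition phi (x : L) : form :=
  fun p => (tnth p (uv_index x false) +i* tnth p (uv_index x true))%:A.
Definition phibar (x : L) : form :=
  fun p => (tnth p (uv_index x false) -i* tnth p (uv_index x true))%:A.

Definition du (x : L) : form := fun=> ext_gen R[i] (uv_index x false).
Definition dv (x : L) : form := fun=> ext_gen R[i] (uv_index x true).
Definition dphi (x : L) : form := du x + 'i *: dv x.
Definition dphibar (x : L) : form := du x - 'i *: dv x.

(* In the remaining definitions, s stands for the chosen square root of 2 pi i. *)
Definition psi (s : R[i]) (x : L) : form := s^-1 *: dphi x.
Definition psibar (s : R[i]) (x : L) : form := s^-1 *: dphibar x.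

Definition form_action (s : R[i]) (A : 'M[R[i]]_#|L|) : form :=
  \sum_x \sum_y entry A x y *: (phi x * phibar y) +
  \sum_x \sum_y entry A x y *: (psi s x * psibar s y).

Definition tau (s : R[i]) (x : L) : form :=
  phi x * phibar x + psi s x * psibar s x.

(* Taylor expansion of exp about the degree-zero part of F, for F of even
   degree: the powers of F - F_0 beyond the #|L|-th have degree larger than
   2 #|L|, hence vanish. *)
Definition form_exp (F : form) : form := fun p =>
  let F0 := F p finset.set0 in
  expC F0 *: \sum_(k < #|L|.+1) (k`!%:R : R[i])^-1 *: (F p - F0%:A) ^+ k.

(* By prod_ext_gen, the coefficient of du_0 dv_0 du_1 dv_1 ... is the one at
   the full set of coordinates. *)
Definition form_integral (F : form) : R[i] :=
  let f p : R[i] := F p [set: 'I_#|L|.*2]%SET in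
  (\int[lebesgue_tuple R #|L|.*2]_p complex.Re (f p)) +i*
  (\int[lebesgue_tuple R #|L|.*2]_p complex.Im (f p)).

End DifferentialForms.

(* Main.v *)
Require Import Defs.
From HB Require Import structures.
From mathcomp Require Import all_boot all_order all_algebra.
From mathcomp Require Import all_classical all_reals all_analysis.
From mathcomp Require Import measurable_realfun complex ring lra.

Set Implicit Arguments.
Unset Strict Implicit.
Unset Printing Implicit Defensive.

Import Order.TTheory GRing.Theory Num.Theory.
Import numFieldNormedType.Exports.

Local Open Scope complex_scope.
Local Open Scope ring_scope.

(** The integral is computed from two integrations by parts, without expanding
    the exponential. Write <F> for the integral of exp(-S_A) F, where F has
    polynomial coefficients, and C for the inverse of A.

    A derivative in phi_y of a polynomial times exp(-phi A phibar) integrates to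
    0, and in the same way a derivative in psi_y has no component of top degree.
    The derivatives of S_A in phi_y and in psi_y are the sums over z of
    A_yz phibar_z and of A_yz psibar_z, so that multiplication by C gives
      <phibar_a F> = sum_y C_ay <d_phi_y F>,
      <psibar_a F> = sum_y C_ay <d_psi_y F>
    (expect_phibar and expect_psibar).

    For a duplicate-free list r let G_r be the product of the 1 + tau_x over r.
    Its derivative in phi_y is phibar_y G_(r - y) when y is in r and 0 otherwise,
    whence
      <phibar_a phi_b G_r> = C_ab <G_r> + sum_(y in r) C_ay <phibar_y phi_b G_(r - y)>
    (expect_pair_phi). Once <G_r> = 1 is known, this is the decomposition of the
    weighted sum over self-avoiding walks from a to b with interior in r
    according to the first step (walk_sum_rec).

    That <G_r> = <1> is supersymmetry: the same two integrations by parts, applied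
    to phi_x phibar_z G_r and to psi_x psibar_z G_r, give recursions whose terms
    C_zx <G_r> have opposite signs, so the sum of the two expectations vanishes by
    induction on r (expect_super_pair), and in particular <tau_x G_r> = 0.

    Finally <1> = 1. Along a path of matrices from A to the identity the
    derivative of <1> is a combination of the expectations of
    phi_x phibar_z + psi_x psibar_z, which vanish for the reason just given, and
    for the identity matrix <1> is a product of one-dimensional Gaussian integrals
    (expect_1). This replaces the computation of a Gaussian integral with a
    non-Hermitian A as a determinant.

    The analytic input is the coercivity of the real part of phi A phibar
    (coercive_of_positive). The Hermitian part of A is positive because that of C
    is, and a positive quadratic form is bounded below on the compact unit sphere.
    All the integrands are then dominated by Gaussians. *)

(** * Contractions on the exterior algebra *)

Section Contraction.
Variables (K : comNzRingType) (n : nat).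
Implicit Types (i j : 'I_n) (f g : extalg K n) (S : {set 'I_n}).

Lemma extDE f g S : (f + g) S = (f S : K) + (g S : K).
Proof. by rewrite ffunE. Qed.

Lemma extNE f S : (- f) S = - (f S : K).
Proof. by rewrite ffunE. Qed.

Lemma extZE (a : K) f S : (a *: f) S = a * (f S : K).
Proof. by rewrite ffunE. Qed.

Lemma ext_sumE (I : Type) (r : seq I) (P : pred I) (F : I -> extalg K n) S :
  (\sum_(i <- r | P i) F i) S = \sum_(i <- r | P i) (F i S : K).
Proof. by apply: (big_morph (fun f => f S)) => [f g|]; rewrite ffunE. Qed.

(** Differentiation with respect to the odd variable e_i: the sign is that of
    moving e_i to the front. *)
Definition ext_contract i f : extalg K n :=
  [ffun S : {set 'I_n} => if i \in S then 0 else
    (-1) ^+ inversions [set i]%SET S * (f (i |: S)%SET : K)].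

Lemma ext_contract_is_linear i : linear (ext_contract i).
Proof.
move=> a f g; apply/ffunP => S; rewrite !ffunE; case: ifP => _.
  by rewrite scaler0 addr0.
by rewrite mulrDr; congr (_ + _); rewrite /GRing.scale /= mulrCA.
Qed.

HB.instance Definition _ i :=
  GRing.isLinear.Build K (extalg K n) (extalg K n) *:%R (ext_contract i)
    (ext_contract_is_linear i).

Lemma ext_contractZ i (a : K) f : ext_contract i (a *: f) = a *: ext_contract i f.
Proof. exact: linearZ. Qed.

Lemma ext_contractD i f g : ext_contract i (f + g) = ext_contract i f + ext_contract i g.
Proof. exact: linearD. Qed.

Lemma ext_contract_top i f : ext_contract i f [set: 'I_n]%SET = 0.
Proof. by rewrite ffunE inE. Qed.

(** The graded Leibniz rule for a generator on the left. When i and j differ,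
    the sign comes from the single inversion between e_i and e_j. *)
Lemma ext_contract_genM i j f :
  ext_contract i (ext_gen K j * f) =
  (i == j)%:R *: f - ext_gen K j * ext_contract i f.
Proof.
apply/ffunP => S; rewrite extDE extNE extZE ffunE !ext_genM.
have cE T : ext_contract i f T = if i \in T then 0 else
    (-1) ^+ inversions [set i]%SET T * (f (i |: T)%SET : K) by rewrite ffunE.
rewrite !cE.
have [<-{j}|ij] := eqVneq i j.
  rewrite finset.setU11 !inE eqxx /= mul1r; case: ifPn => iS.
    by rewrite finset.setD1K // mulrA -expr2 sqrr_sign mul1r subrr.
  by rewrite finset.setU1K // mulrA -expr2 sqrr_sign mul1r subr0.
rewrite !inE ij mul0r add0r /= (eq_sym j) (negPf ij) /=.
case: (boolP (j \in S)) => jS; last by case: ifP; rewrite oppr0 ?mulr0.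
case: (boolP (i \in S)) => iS /=; first by rewrite mulr0 oppr0.
have -> : ((i |: S) :\ j = i |: (S :\ j))%SET.
  by apply/setP => x; rewrite !inE; case: eqVneq => [->|]; rewrite ?orbF //= eq_sym (negPf ij).
have dj : [disjoint [set j]%SET & (S :\ j)%SET]%bool.
  by rewrite finset.disjoints1 !inE eqxx.
have di : [disjoint [set i]%SET & (S :\ j)%SET]%bool.
  by rewrite finset.disjoints1 !inE (negPf iS) andbF.
rewrite -{1}(finset.setD1K jS) !inversionsUr // !exprD.
have sg : (-1) ^+ inversions [set i]%SET [set j]%SET *
    (-1) ^+ inversions [set j]%SET [set i]%SET = -1 :> K.
  rewrite /inversions !finset.big_set1 -exprD.
  by case: (ltngtP i j) => [_|_|/val_inj ijE] //; rewrite ijE eqxx in ij.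
rewrite !mulrA -[in LHS](mulrA _ _ ((-1) ^+ inversions [set j]%SET [set i]%SET)).
rewrite -[in LHS](mulrC ((-1) ^+ inversions [set j]%SET [set i]%SET)) !mulrA sg.
by rewrite mulN1r !mulNr; congr (- (_ * _)); rewrite mulrC.
Qed.

Lemma ext_contract_lincombM i j k (a c : K) f :
  ext_contract i (a *: (ext_gen K j + c *: ext_gen K k) * f) =
  (a * ((i == j)%:R + c * (i == k)%:R)) *: f -
  a *: (ext_gen K j + c *: ext_gen K k) * ext_contract i f.
Proof.
rewrite -!scalerAl !mulrDl -!scalerAl ext_contractZ ext_contractD ext_contractZ.
rewrite !ext_contract_genM; apply/ffunP => S; rewrite !(extDE, extNE, extZE).
by ring.
Qed.

Definition degree_ge d f := forall S, (#|S| < d)%N -> f S = 0.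

(** The source of all nilpotency below: no subset of the generators has more than
    n elements. *)
Lemma degree_ge_eq0 d f : (n < d)%N -> degree_ge d f -> f = 0.
Proof.
move=> nd fd; apply/ffunP => S; rewrite ffunE; apply: fd.
by apply: leq_ltn_trans nd; rewrite -[n in (_ <= n)%N]card_ord max_card.
Qed.

Lemma degree_geD d f g : degree_ge d f -> degree_ge d g -> degree_ge d (f + g).
Proof. by move=> fd gd S Sd; rewrite ffunE fd // gd // addr0. Qed.

Lemma degree_geZ d a f : degree_ge d f -> degree_ge d (a *: f).
Proof. by move=> fd S Sd; rewrite ffunE fd // scaler0. Qed.

Lemma degree_ge_sum d (I : Type) (r : seq I) (P : pred I) (F : I -> extalg K n) :
  (forall k, P k -> degree_ge d (F k)) -> degree_ge d (\sum_(k <- r | P k) F k).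
Proof.
move=> Fd; elim/big_rec: _ => [S _|k f Pk fd]; first by rewrite ffunE.
by apply: degree_geD fd; apply: Fd.
Qed.

Lemma degree_ge_genM d i f : degree_ge d f -> degree_ge d.+1 (ext_gen K i * f).
Proof.
move=> fd S Sd; rewrite ext_genM; case: ifP => // iS.
by rewrite fd ?mulr0 //; move: Sd; rewrite (finset.cardsD1 i) iS.
Qed.

End Contraction.

(** * The Grassmann variables psi and psibar *)

Section Anticommutation.
Variables (K : comNzRingType) (n : nat).
Implicit Types (f g h : extalg K n).

Definition anticomm f g := f * g = - (g * f).

Lemma anticomm_sym f g : anticomm f g -> anticomm g f.
Proof. by rewrite /anticomm => ->; rewrite opprK. Qed.

Lemma anticommDr f g h : anticomm f g -> anticomm f h -> anticomm f (g + h).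
Proof. by rewrite /anticomm => fg fh; rewrite mulrDr mulrDl fg fh opprD. Qed.

Lemma anticommZr a f g : anticomm f g -> anticomm f (a *: g).
Proof. by rewrite /anticomm => fg; rewrite -scalerAr -scalerAl fg scalerN. Qed.

Lemma anticommDl f g h : anticomm f h -> anticomm g h -> anticomm (f + g) h.
Proof. by move=> fh gh; apply/anticomm_sym/anticommDr; exact: anticomm_sym. Qed.

Lemma anticommZl a f g : anticomm f g -> anticomm (a *: f) g.
Proof. by move=> fg; apply/anticomm_sym/anticommZr/anticomm_sym. Qed.

(** A product of two odd elements is even, hence commutes with odd elements. *)
Lemma anticomm_comm f g h : anticomm f h -> anticomm g h -> GRing.comm (f * g) h.
Proof.
by rewrite /anticomm /GRing.comm => fh gh; rewrite -mulrA gh mulrN !mulrA fh mulNr opprK.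
Qed.

Lemma commZr a f g : GRing.comm f g -> GRing.comm f (a *: g).
Proof. by rewrite /GRing.comm -scalerAr -scalerAl => ->. Qed.

Lemma anticomm_lincomb i j k l (a b c d : K) :
  anticomm (a *: (ext_gen K i + c *: ext_gen K j))
           (b *: (ext_gen K k + d *: ext_gen K l)).
Proof.
apply/anticommZl/anticommZr/anticommDl; last apply: anticommZl.
  by apply: anticommDr; [|apply: anticommZr]; exact: ext_gen_anticomm.
by apply: anticommDr; [|apply: anticommZr]; exact: ext_gen_anticomm.
Qed.

End Anticommutation.

(** The variables psi and psibar are used only through their anticommutation
    relations and the derivations dual to psi, so these elements are sealed. *)
HB.lock Definition grass_psi (K : numClosedFieldType) (L : finType) (s : K) (x : L) :
    extalg K #|L|.*2 :=
  s^-1 *: (ext_gen K (uv_index x false) + 'i *: ext_gen K (uv_index x true)).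

HB.lock Definition grass_psibar (K : numClosedFieldType) (L : finType) (s : K) (x : L) :
    extalg K #|L|.*2 :=
  s^-1 *: (ext_gen K (uv_index x false) + - 'i *: ext_gen K (uv_index x true)).

(** The contraction with the vector field dual to psi_y: an odd derivation that
    sends psi_y to 1 and the other generators psi_x, psibar_x to 0. *)
HB.lock Definition grass_dpsi (K : numClosedFieldType) (L : finType) (s : K) (y : L)
    (f : extalg K #|L|.*2) : extalg K #|L|.*2 :=
  (s / 2) *: (ext_contract (uv_index y false) f - 'i *: ext_contract (uv_index y true) f).

HB.lock Definition ferm_action (K : numClosedFieldType) (L : finType) (s : K)
    (A : L -> L -> K) : extalg K #|L|.*2 :=
  \sum_x \sum_y A x y *: (grass_psi s x * grass_psibar s y).

Section Grassmann.
Variables (K : numClosedFieldType) (L : finType) (s : K).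
Local Notation ext := (extalg K #|L|.*2).
Local Notation grass_psi := (@grass_psi K L s).
Local Notation grass_psibar := (@grass_psibar K L s).
Local Notation grass_dpsi := (@grass_dpsi K L s).
Local Notation ferm_action := (@ferm_action K L s).
Implicit Types (x y z : L) (f g h : ext) (A B : L -> L -> K).

Lemma uv_index_inj x y c d : (uv_index x c == uv_index y d) = (x == y) && (c == d).
Proof.
apply/eqP/andP => [/(congr1 val)/= xy|[/eqP -> /eqP ->] //].
have cd : c = d.
  have /(congr1 odd) := xy.
  by rewrite !oddD !odd_double; case: c {xy}; case: d.
split; last exact/eqP.
apply/eqP/enum_rank_inj/val_inj/double_inj; move: xy; rewrite cd.
exact: addIn.
Qed.

Lemma psi_psi x y : anticomm (grass_psi x) (grass_psi y).
Proof. rewrite ?grass_psi.unlock ?grass_psibar.unlock; exact: anticomm_lincomb. Qed.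

Lemma psi_psibar x y : anticomm (grass_psi x) (grass_psibar y).
Proof. rewrite ?grass_psi.unlock ?grass_psibar.unlock; exact: anticomm_lincomb. Qed.

Lemma psibar_psibar x y : anticomm (grass_psibar x) (grass_psibar y).
Proof. rewrite ?grass_psi.unlock ?grass_psibar.unlock; exact: anticomm_lincomb. Qed.

Lemma pair_psibar x y z : GRing.comm (grass_psi x * grass_psibar y) (grass_psibar z).
Proof. by apply: anticomm_comm; [exact: psi_psibar | exact: psibar_psibar]. Qed.

Lemma pair_psi x y z : GRing.comm (grass_psi x * grass_psibar y) (grass_psi z).
Proof.
by apply: anticomm_comm; [exact: psi_psi | exact/anticomm_sym/psi_psibar].
Qed.

Lemma pair_pair x y z w :
  GRing.comm (grass_psi x * grass_psibar y) (grass_psi z * grass_psibar w).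
Proof. by apply: commrM; [exact: pair_psi | exact: pair_psibar]. Qed.

Lemma action_psibar A z : GRing.comm (ferm_action A) (grass_psibar z).
Proof.
apply: commr_sym; rewrite ferm_action.unlock; do 2 (apply: commr_sum => ? _); apply/commZr/commr_sym.
exact: pair_psibar.
Qed.

Lemma action_action A B : GRing.comm (ferm_action A) (ferm_action B).
Proof.
rewrite ferm_action.unlock; do 2 (apply: commr_sum => ? _); apply: commZr; apply: commr_sym.
do 2 (apply: commr_sum => ? _); apply: commZr; exact: pair_pair.
Qed.

Lemma degree_ge_psi d x f : degree_ge d f -> degree_ge d.+1 (grass_psi x * f).
Proof.
move=> fd; rewrite grass_psi.unlock -scalerAl mulrDl -scalerAl.
by apply/degree_geZ/degree_geD; [|apply: degree_geZ]; exact: degree_ge_genM.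
Qed.

Lemma degree_ge_psibar d x f : degree_ge d f -> degree_ge d.+1 (grass_psibar x * f).
Proof.
move=> fd; rewrite grass_psibar.unlock -scalerAl mulrDl -scalerAl.
by apply/degree_geZ/degree_geD; [|apply: degree_geZ]; exact: degree_ge_genM.
Qed.

Lemma degree_ge_action d A f : degree_ge d f -> degree_ge d.+2 (ferm_action A * f).
Proof.
move=> fd; rewrite ferm_action.unlock mulr_suml; apply: degree_ge_sum => x _.
rewrite mulr_suml; apply: degree_ge_sum => y _.
by rewrite -scalerAl -mulrA; apply/degree_geZ/degree_ge_psi/degree_ge_psibar.
Qed.

Lemma degree_ge_actionX k A : degree_ge k.*2 (ferm_action A ^+ k).
Proof.
elim: k => [S //|k IHk]; rewrite exprS doubleS; exact: degree_ge_action.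
Qed.

Hypothesis s_neq0 : s != 0.

Lemma dpsiE y f : grass_dpsi y f = (s / 2) *:
  (ext_contract (uv_index y false) f - 'i *: ext_contract (uv_index y true) f).
Proof. by rewrite grass_dpsi.unlock. Qed.

Lemma grass_dpsi_is_linear y : linear (grass_dpsi y).
Proof.
move=> a f g; rewrite !dpsiE !linearP; apply/ffunP => S.
by rewrite !(extDE, extNE, extZE); ring.
Qed.

HB.instance Definition _ y := GRing.isLinear.Build K ext ext *:%R (grass_dpsi y)
  (grass_dpsi_is_linear y).

Lemma dpsiZ y a f : grass_dpsi y (a *: f) = a *: grass_dpsi y f.
Proof. exact: linearZ. Qed.

Lemma dpsiN y f : grass_dpsi y (- f) = - grass_dpsi y f.
Proof. exact: linearN. Qed.

Lemma dpsiD y f g : grass_dpsi y (f + g) = grass_dpsi y f + grass_dpsi y g.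
Proof. exact: linearD. Qed.

Lemma dpsi_sum y (I : Type) (r : seq I) (P : pred I) (F : I -> ext) :
  grass_dpsi y (\sum_(k <- r | P k) F k) = \sum_(k <- r | P k) grass_dpsi y (F k).
Proof. exact: linear_sum. Qed.

Lemma dpsi_top y f : grass_dpsi y f [set: 'I_#|L|.*2]%SET = 0.
Proof. by rewrite dpsiE extZE extDE extNE extZE !ext_contract_top mulr0 subr0 mulr0. Qed.

(** The factor 1 - 'i * c is 2 for psi, where c is 'i, and 0 for psibar, where c
    is - 'i. *)
Lemma dpsi_lincombM y x (a c : K) f :
  grass_dpsi y (a *: (ext_gen K (uv_index x false) + c *: ext_gen K (uv_index x true)) * f) =
  (s / 2 * a * (x == y)%:R * (1 - 'i * c)) *: f
  - a *: (ext_gen K (uv_index x false) + c *: ext_gen K (uv_index x true)) * grass_dpsi y f.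
Proof.
rewrite !dpsiE !ext_contract_lincombM !uv_index_inj !andbT !andbF (eq_sym y).
set X := a *: (_ + _); have -> : X * ((s / 2) *: (ext_contract (uv_index y false) f -
    'i *: ext_contract (uv_index y true) f)) = (s / 2) *:
    (X * ext_contract (uv_index y false) f - 'i *: (X * ext_contract (uv_index y true) f)).
  by rewrite -scalerAr mulrBr -scalerAr.
move: X => X; move: (ext_contract _ f) (ext_contract _ f) => U V.
apply/ffunP => S; rewrite !(extDE, extNE, extZE).
rewrite [false%:R]mulr0n.
by ring.
Qed.

Lemma dpsi_psiM y x f :
  grass_dpsi y (grass_psi x * f) = (x == y)%:R *: f - grass_psi x * grass_dpsi y f.
Proof.
rewrite grass_psi.unlock dpsi_lincombM -expr2 sqrCi opprK; congr (_ *: _ - _).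
have s2 : s / 2 * s^-1 * (1 + 1) = 1 by field; rewrite s_neq0.
by rewrite mulrAC s2 mul1r.
Qed.

Lemma dpsi_psibarM y x f :
  grass_dpsi y (grass_psibar x * f) = - (grass_psibar x * grass_dpsi y f).
Proof.
rewrite grass_psibar.unlock dpsi_lincombM mulrN -expr2 sqrCi opprK subrr mulr0.
by rewrite scale0r add0r.
Qed.

End Grassmann.

(** * Integration by parts for Gaussian Berezin integrals *)

(** The derivative of the fermionic action with respect to psi_y. *)
HB.lock Definition action_row (K : numClosedFieldType) (L : finType) (s : K)
    (A : L -> L -> K) (y : L) : extalg K #|L|.*2 :=
  \sum_z A y z *: grass_psibar s z.

Section FermionicGaussian.
Variables (K : numClosedFieldType) (L : finType) (s : K).
Local Notation ext := (extalg K #|L|.*2).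
Local Notation psi := (@grass_psi K L s).
Local Notation psibar := (@grass_psibar K L s).
Local Notation action_row := (@action_row K L s).
Local Notation action := (@ferm_action K L s).
Implicit Types (x y z : L) (f g h P : ext) (A B : L -> L -> K).

Definition trunc_exp P : ext := \sum_(k < #|L|.+1) (k`!%:R : K)^-1 *: P ^+ k.

Definition ferm_exp A : ext := trunc_exp (- action A).

Lemma exp_psibar A z : GRing.comm (ferm_exp A) (psibar z).
Proof.
apply/commr_sym/commr_sum => k _; apply/commZr/commrX/commrN/commr_sym.
exact: action_psibar.
Qed.

Lemma action_action_row A B y : GRing.comm (action A) (action_row B y).
Proof. by rewrite action_row.unlock; apply: commr_sum => z _; apply/commZr/action_psibar. Qed.

(** The degree of this product is 2 #|L| + 1. *)
Lemma action_row_top A B y : action_row B y * (- action A) ^+ #|L| = 0.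
Proof.
apply: (@degree_ge_eq0 _ _ #|L|.*2.+1) => //.
rewrite -scaleN1r exprZn -scalerAr; apply: degree_geZ.
rewrite action_row.unlock mulr_suml; apply: degree_ge_sum => z _; rewrite -scalerAl.
by apply/degree_geZ/degree_ge_psibar/degree_ge_actionX.
Qed.

(** A derivation lowers the order of truncation by one; the last term is split off
    because action_row_top makes the difference harmless. *)
Lemma trunc_exp_recr P : trunc_exp P =
  (\sum_(k < #|L|) (k`!%:R : K)^-1 *: P ^+ k) + ((#|L|)`!%:R : K)^-1 *: P ^+ #|L|.
Proof. by rewrite /trunc_exp big_ord_recr. Qed.

Lemma fact_invS k : ((k.+1)`!%:R : K)^-1 * k.+1%:R = (k`!%:R : K)^-1.
Proof.
by rewrite factS natrM invfM mulrAC mulVf ?mul1r // pnatr_eq0.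
Qed.

Hypothesis s_neq0 : s != 0.
Local Notation dpsi := (@grass_dpsi K L s).

Lemma dpsi_pairM y x z f :
  dpsi y (psi x * psibar z * f) =
  (x == y)%:R *: (psibar z * f) + psi x * psibar z * dpsi y f.
Proof. by rewrite -mulrA dpsi_psiM // dpsi_psibarM // mulrN opprK mulrA. Qed.

Lemma dpsi_actionM A y f :
  dpsi y (action A * f) = action_row A y * f + action A * dpsi y f.
Proof.
rewrite ferm_action.unlock action_row.unlock !mulr_suml dpsi_sum.
rewrite (eq_bigr (fun x => (x == y)%:R *: (\sum_z A y z *: psibar z * f)
  + (\sum_z A x z *: (psi x * psibar z)) * dpsi y f)); last first.
  move=> x _; rewrite !mulr_suml dpsi_sum scaler_sumr -big_split.
  apply: eq_bigr => z _; rewrite -!scalerAl dpsiZ dpsi_pairM scalerDr.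
  congr (_ + _); have [->|] := eqVneq x y; first by rewrite !scale1r.
  by rewrite !scale0r scaler0.
rewrite big_split /= (bigD1 y) //= eqxx scale1r [X in _ + X + _]big1 ?addr0 //.
by move=> x /negPf ->; rewrite scale0r.
Qed.

Lemma dpsi_1 y : dpsi y 1 = 0.
Proof.
have c1 i : ext_contract i (1 : ext) = 0.
  apply/ffunP => S; rewrite !ffunE; case: ifP => // _.
  rewrite (_ : (_ == _) = false) ?mulr0 //; apply/negbTE/eqP => /setP/(_ i).
  by rewrite !inE eqxx.
by rewrite dpsiE !c1 scaler0 subrr scaler0.
Qed.

(** The power rule holds since the action, being even, commutes with its
    derivative. *)
Lemma dpsi_actionXM A y k f :
  dpsi y ((- action A) ^+ k * f) =
  - (k%:R *: (action_row A y * (- action A) ^+ k.-1 * f))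
  + (- action A) ^+ k * dpsi y f.
Proof.
elim: k f => [|k IHk] f; first by rewrite scale0r oppr0 add0r !mul1r.
have cNr : GRing.comm (- action A) (action_row A y).
  by apply/commr_sym/commrN/commr_sym/action_action_row.
rewrite exprS -mulrA mulNr dpsiN dpsi_actionM IHk mulrDr addrA opprD.
congr (_ + _); last by rewrite -mulrA mulNr.
have e : action A * (k%:R *: (action_row A y * (- action A) ^+ k.-1 * f)) =
    - (k%:R *: (action_row A y * (- action A) ^+ k * f)).
  case: (k) => [|m]; first by rewrite !scale0r mulr0 oppr0.
  rewrite -scalerAr -scalerN exprS; congr (_ *: _) => /=.
  by rewrite !mulrA mulrN !mulNr opprK action_action_row.
by rewrite mulrN e opprK mulrA -nat1r scalerDl scale1r.
Qed.

Lemma dpsi_expM A y f : dpsi y (ferm_exp A * f) =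
  - (action_row A y * (ferm_exp A * f)) + ferm_exp A * dpsi y f.
Proof.
have rowE : action_row A y * ferm_exp A = action_row A y *
    \sum_(k < #|L|) (k`!%:R : K)^-1 *: (- action A) ^+ k.
  by rewrite /ferm_exp trunc_exp_recr mulrDr -scalerAr action_row_top scaler0 addr0.
have expM g : ferm_exp A * g =
    \sum_(k < #|L|.+1) (k`!%:R : K)^-1 *: ((- action A) ^+ k * g).
  by rewrite mulr_suml; apply: eq_bigr => k _; rewrite -scalerAl.
rewrite mulrA rowE !expM dpsi_sum.
rewrite (eq_bigr (fun k : 'I_#|L|.+1 => - ((k`!%:R : K)^-1 * k%:R) *:
    (action_row A y * (- action A) ^+ k.-1 * f) +
    (k`!%:R : K)^-1 *: ((- action A) ^+ k * dpsi y f))); last first.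
  move=> k _; rewrite dpsiZ dpsi_actionXM scalerDr scalerN scalerA.
  by rewrite scaleNr.
rewrite big_split /=; congr (_ + _).
rewrite big_ord_recl mulr0 oppr0 scale0r add0r mulr_sumr mulr_suml -sumrN.
apply: eq_bigr => k _; rewrite lift0 fact_invS scaleNr.
by rewrite -scalerAr -scalerAl.
Qed.

(** The derivative of the exponential times f has no component of top degree. *)
Lemma ferm_ibp A y f :
  \sum_z A y z * ((ferm_exp A * (psibar z * f)) [set: 'I_#|L|.*2]%SET : K) =
  (ferm_exp A * dpsi y f) [set: 'I_#|L|.*2]%SET.
Proof.
have := dpsi_top s y (ferm_exp A * f); rewrite dpsi_expM extDE extNE.
move/eqP; rewrite addrC subr_eq0 => /eqP ->; rewrite action_row.unlock mulr_suml ext_sumE.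
apply: eq_bigr => z _.
by rewrite -scalerAl extZE (mulrA (psibar z)) -exp_psibar -mulrA.
Qed.

End FermionicGaussian.

(** * Gaussian bounds on the line *)

Lemma EFin_Rintegral d (T : measurableType d) (R : realType)
    (mu : {measure set T -> \bar R}) (f : T -> R) :
  (mu.-integrable [set: T]%classic (EFin \o f) ->
  (\int[mu]_x f x)%R%:E = \int[mu]_x (f x)%:E)%E.
Proof. by move=> fi; rewrite fineK //; exact: integrable_fin_num. Qed.

Section GaussianLine.
Variable R : realType.
Local Open Scope classical_set_scope.
Local Notation mu := (@lebesgue_measure R).
Implicit Types (c K x : R).

Definition gauss c x : R := expR (- (c * x ^+ 2)).

Lemma integrable_gauss c : 0 < c -> mu.-integrable setT (EFin \o gauss c).
Proof.
(* The density of the normal law of variance sg ^ 2 is proportional to gauss c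
   when 2 sg ^ 2 = 1 / c. *)
move=> c0; pose sg := Num.sqrt (2 * c)^-1.
have c20 : 0 < (2 * c)^-1 by rewrite invr_gt0 mulr_gt0.
have sg0 : sg != 0 by rewrite gt_eqF // sqrtr_gt0.
have -> : EFin \o gauss c =
    (fun x => (normal_peak sg)^-1%:E * (normal_pdf 0 sg x)%:E)%E.
  apply/funext => x; rewrite normal_pdfE // -EFinM mulKf; last first.
    by rewrite gt_eqF // normal_peak_gt0.
  rewrite /= /gauss /normal_fun subr0 sqr_sqrtr; last exact: ltW.
  congr (expR _)%:E; field; rewrite gt_eqF //.
by apply: integrableZl => //; exact: integrable_normal_pdf.
Qed.

Lemma integral_gauss1 : \int[mu]_x gauss 1 x = Num.sqrt pi.
Proof.
rewrite /Rintegral -[RHS]/(fine (Num.sqrt pi)%:E) -integralT_gauss; congr fine.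
by apply: eq_integral => x _; rewrite /gauss mul1r.
Qed.

(** A crude bound, which suffices for the limit at infinity. *)
Lemma gauss_le_inv c n : 0 < c -> gauss c n.+1%:R <= (c * n.+1%:R)^-1.
Proof.
move=> c0; have cn0 : 0 < c * n.+1%:R by rewrite mulr_gt0.
rewrite /gauss expRN lef_pV2 ?posrE ?expR_gt0 //.
apply: le_trans (expR_ge1Dx _); apply: ler_wpDl => //.
by rewrite ler_pM2l // expr2 ler_peMl // ler1n.
Qed.

Lemma cvg_gauss_n c : 0 < c -> (gauss c n.+1%:R) @[n --> \oo] --> (0 : R).
Proof.
move=> c0; apply: (@squeeze_cvgr _ _ _ _ (fun=> 0) (fun n => (c * n.+1%:R)^-1)).
- by near=> n; rewrite expR_ge0 gauss_le_inv.
- exact: cvg_cst.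
- have : (c^-1 * n.+1%:R^-1) @[n --> \oo] --> c^-1 * 0.
    by apply: cvgMr; exact: cvg_harmonic.
  by rewrite mulr0; under eq_fun do rewrite -invfM.
Unshelve. all: by end_near. Qed.

Lemma integrable_gauss_line c K (f : R -> R) : 0 < c -> measurable_fun setT f ->
  (forall x, `|f x| <= K * gauss c x) -> mu.-integrable setT (EFin \o f).
Proof.
move=> c0 mf fK.
have gi : mu.-integrable setT (fun x => (K%:E * (gauss c x)%:E)%E).
  by apply: integrableZl => //; exact: integrable_gauss.
apply: le_integrable gi => //; first exact/measurable_EFinP.
move=> t _; rewrite /= lee_fin (le_trans (fK t)) //; exact: ler_norm.
Qed.

(** The fundamental theorem of calculus on [-n, n], as n tends to infinity. *)
Lemma integral_derivative_line c K (h h' : R -> R) : 0 < c ->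
  (forall x, is_derive x (1 : R) h (h' x)) -> continuous h' ->
  (forall x, `|h x| <= K * gauss c x) -> (forall x, `|h' x| <= K * gauss c x) ->
  \int[mu]_x h' x = 0.
Proof.
move=> c0 hh' ch' hK h'K.
have int_g : mu.-integrable setT (EFin \o (fun x => K * gauss c x)).
  rewrite /comp; under eq_fun do rewrite EFinM.
  by apply: integrableZl => //; exact: integrable_gauss.
have mh' : measurable_fun [set: R] h' by exact: continuous_measurable_fun.
pose I n : set R := `[- n.+1%:R, n.+1%:R].
have mI n : measurable (I n) by exact: measurable_itv.
have cvg_int : (\int[mu]_(x in I n) (h' x)%:E)%E @[n --> \oo] -->
    (\int[mu]_x (h' x)%:E)%E.
  under eq_cvg do rewrite integral_mkcond.
  apply: (@dominated_cvg _ _ _ mu _ measurableT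
    (fun n => (fun x => (h' x)%:E) \_ (I n)) (fun x => (h' x)%:E) (EFin \o (fun x => K * gauss c x))) => //.
  - move=> n; apply: (measurable_restrictT _ (mI n)).1.
    by apply/measurable_EFinP; exact: measurable_funTS.
  - move=> x _; apply: cvg_near_cst; near=> n.
    rewrite patchE mem_set // /I /= in_itv /= -ler_norml.
    rewrite (le_trans (ltW (truncnS_gt _))) // ler_nat ltnS.
    by near: n; exists (Num.truncn `|x|).
  - move=> n x _ /=; rewrite patchE; case: ifP => _; first by rewrite lee_fin.
    by rewrite abse0 lee_fin (le_trans _ (h'K x)).
have FTC n : (\int[mu]_(x in I n) (h' x)%:E)%E = (h n.+1%:R - h (- n.+1%:R))%:E.
  rewrite (@continuous_FTC2 _ h' h) ?EFinB //.
  - by rewrite gtrN.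
  - exact: continuous_subspaceT.
  - have ch x : {for x, continuous h}.
      by apply/differentiable_continuous/derivable1_diffP; exact: ex_derive.
    split=> [x _||]; [exact: ex_derive|apply: cvg_at_right_filter; exact: ch|apply: cvg_at_left_filter; exact: ch].
  - by move=> x _; rewrite derive1E; exact: derive_val.
have lim0 : (h n.+1%:R - h (- n.+1%:R)) @[n --> \oo] --> (0 : R).
  have b : (2 * K * gauss c n.+1%:R) @[n --> \oo] --> (0 : R).
    by rewrite -(mulr0 (2 * K)); apply: cvgMr; exact: cvg_gauss_n.
  apply: (@squeeze_cvgr _ _ _ _ (fun n => - (2 * K * gauss c n.+1%:R)) _ _ _ _ _ b).
    near=> n; rewrite -ler_norml (le_trans (ler_normB _ _)) //.
    have := hK (- n.+1%:R); rewrite /gauss sqrrN -/(gauss _ _) => h1.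
    by rewrite -mulrA mulr_natl mulr2n lerD.
  by rewrite -oppr0; exact: cvgN.
rewrite /Rintegral (cvg_unique _ cvg_int (_ : _ --> 0%E)) //.
by under eq_cvg do rewrite FTC; apply: cvg_EFin => //; exact: nearW.
Unshelve. all: by end_near. Qed.

End GaussianLine.

(** * Gaussian bounds in several variables *)

Section GaussianTuple.
Variable R : realType.
Local Open Scope classical_set_scope.
Local Notation mu := (@lebesgue_measure R).
Local Notation point n := (n.-tuple (measurableTypeR R)).
Local Notation leb n := (lebesgue_tuple R n).
Implicit Types (n : nat) (c K x : R).

Definition sqnorm n (t : point n) : R := \sum_(i < n) tnth t i ^+ 2.

Definition ngauss c n (t : point n) : R := expR (- (c * sqnorm t)).

Lemma sqnorm_ge0 n (t : point n) : 0 <= sqnorm t.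
Proof. by apply: sumr_ge0 => i _; exact: sqr_ge0. Qed.

Lemma sqnorm_cons n x (t : point n) : sqnorm (cons_pair (x, t)) = x ^+ 2 + sqnorm t.
Proof.
rewrite /sqnorm big_ord_recl; congr (_ + _).
by apply: eq_bigr => i _; rewrite tnthS.
Qed.

Lemma ngauss_cons c n x (t : point n) :
  ngauss c (cons_pair (x, t)) = gauss c x * ngauss c t.
Proof. by rewrite /ngauss sqnorm_cons -expRD mulrDr opprD. Qed.

Lemma measurable_coord n (i : 'I_n) : measurable_fun setT (fun t : point n => tnth t i : R).
Proof. exact: measurable_tnth. Qed.

Lemma measurable_sqnorm n : measurable_fun setT (@sqnorm n).
Proof.
apply: measurable_sum => i; apply: measurable_funX; exact: measurable_coord.
Qed.

Lemma measurable_ngauss c n : measurable_fun setT (@ngauss c n).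
Proof.
apply: measurableT_comp => //; apply: measurableT_comp => //.
by apply: measurable_funM => //; exact: measurable_sqnorm.
Qed.

Lemma integrable_lebesgue_tupleS n (f : point n.+1 -> \bar R) :
  measurable_fun setT f ->
  (mu \x leb n)%E.-integrable setT (f \o @cons_pair R n) ->
  (leb n.+1).-integrable setT f.
Proof.
move=> mf fi; apply: (@integrable_pushforward _ _ _ _ _ (@cons_pair R n)) => //.
exact: measurable_cons_pair.
Qed.

Lemma integral_lebesgue_tupleS n (f : point n.+1 -> \bar R) :
  measurable_fun setT f ->
  (mu \x leb n)%E.-integrable setT (f \o @cons_pair R n) ->
  (\int[leb n.+1]_t f t = \int[(mu \x leb n)]_p f (cons_pair p))%E.
Proof.
move=> mf fi.
have := @integral_pushforward _ _ _ _ R _ (@measurable_cons_pair R n)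
  (mu \x leb n)%E setT f mf fi measurableT.
exact.
Qed.

Lemma integrable_tensor n (f : R -> R) (g : point n -> R) :
  mu.-integrable setT (EFin \o f) -> (leb n).-integrable setT (EFin \o g) ->
  (mu \x leb n)%E.-integrable setT (fun p => (f p.1 * g p.2)%:E).
Proof.
move=> fi gi.
have mf : measurable_fun setT f by apply/measurable_EFinP; exact: measurable_int fi.
have mg : measurable_fun setT g by apply/measurable_EFinP; exact: measurable_int gi.
apply/integrable12ltyP => /=.
  apply/measurable_EFinP; apply: measurable_funM.
    by apply: measurableT_comp => //; exact: measurable_fst.
  by apply: measurableT_comp => //; exact: measurable_snd.
have -> : (fun x => \int[leb n]_y `|(f x * g y)%:E|)%E =
    (fun x => `|f x|%:E * \int[leb n]_y `|(g y)%:E|)%E.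
  apply/funext => x; rewrite -ge0_integralZl//.
  - by apply: eq_integral => y _; rewrite -EFinM -normrM.
  - by do 2 apply: measurableT_comp => //.
have /integrableP[_ gfin] := gi; have /integrableP[_ ffin] := fi.
have G0 : (0 <= \int[leb n]_y `|(g y)%:E|)%E by exact: integral_ge0.
rewrite ge0_integralZr //; last by do 2 apply: measurableT_comp => //.
apply: lte_mul_pinfty => //; first exact: integral_ge0.
by rewrite ge0_fin_numE //; exact: integral_ge0.
Qed.

Lemma integrable_ngauss c n : 0 < c -> (leb n).-integrable setT (EFin \o @ngauss c n).
Proof.
move=> c0; elim: n => [|n IHn].
  apply/integrableP; split; first by apply/measurable_EFinP; exact: measurable_ngauss.
  rewrite /= integral_dirac //; first by rewrite diracT mul1e ltry.
  by do 2 apply: measurableT_comp => //; exact: measurable_ngauss.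
apply: integrable_lebesgue_tupleS.
  by apply/measurable_EFinP; exact: measurable_ngauss.
have := integrable_tensor (integrable_gauss c0) IHn.
apply: eq_integrable => // -[x t] _ /=.
by rewrite ngauss_cons.
Qed.

Lemma integral_ngauss1 n : \int[leb n]_t ngauss 1 t = Num.sqrt pi ^+ n.
Proof.
suff IH : (\int[leb n]_t (ngauss 1 t)%:E = (Num.sqrt pi ^+ n)%:E)%E.
  by rewrite /Rintegral IH.
elim: n => [|n IHn].
  rewrite /= integral_dirac //; last first.
    by apply/measurable_EFinP; exact: measurable_ngauss.
  by rewrite diracT mul1e /ngauss /sqnorm big_ord0 mulr0 oppr0 expR0.
have gi := integrable_tensor (integrable_gauss (@ltr01 R)) (integrable_ngauss n (@ltr01 R)).
have e : (fun p : R * point n => (gauss 1 p.1 * ngauss 1 p.2)%:E) =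
    (EFin \o @ngauss 1 n.+1) \o @cons_pair R n.
  by apply/funext => -[x t]; rewrite /= ngauss_cons.
rewrite integral_lebesgue_tupleS; last 2 first.
- by apply/measurable_EFinP; exact: measurable_ngauss.
- by rewrite -e.
rewrite -integral12_prod_meas1; last by rewrite e in gi.
rewrite /fubini_F exprS.
transitivity (\int[mu]_x ((gauss 1 x)%:E * (Num.sqrt pi ^+ n)%:E))%E.
  apply: eq_integral => x _; rewrite -IHn -integralZl //; last exact: integrable_ngauss.
  by apply: eq_integral => t _; rewrite ngauss_cons.
rewrite integralZr //; last exact: integrable_gauss.
rewrite -[in RHS]integral_gauss1 EFinM; congr (_ * _)%E.
  by rewrite EFin_Rintegral //; exact: integrable_gauss.
by rewrite integral_gauss1.
Qed.

Definition upd n (i : 'I_n) (t : point n) x : point n :=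
  [tuple if j == i then x else tnth t j | j < n].

Lemma upd_cons0 n x (t : point n) y : upd ord0 (cons_pair (x, t)) y = cons_pair (y, t).
Proof.
apply: eq_from_tnth => j; rewrite tnth_mktuple.
by case: (unliftP ord0 j) => [j' ->|->]; rewrite ?tnth0 ?tnthS.
Qed.

Lemma upd_consS n x (t : point n) (i : 'I_n) y :
  upd (lift ord0 i) (cons_pair (x, t)) y = cons_pair (x, upd i t y).
Proof.
apply: eq_from_tnth => j; rewrite tnth_mktuple.
by case: (unliftP ord0 j) => [j' ->|->]; rewrite ?tnth0 ?tnthS ?tnth_mktuple.
Qed.

Lemma integrable_gauss_bound c K n (f : point n -> R) : 0 < c ->
  measurable_fun setT f -> (forall t, `|f t| <= K * ngauss c t) ->
  (leb n).-integrable setT (EFin \o f).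
Proof.
move=> c0 mf fK.
have gi : (leb n).-integrable setT (fun t => (K%:E * (ngauss c t)%:E)%E).
  by apply: integrableZl => //; exact: integrable_ngauss.
apply: le_integrable gi => //; first exact/measurable_EFinP.
move=> t _; rewrite /= lee_fin (le_trans (fK t)) //; exact: ler_norm.
Qed.

(** By Fubini, the coordinate that the derivative acts on can be integrated
    first, and this integral vanishes. *)
Lemma integral_partial c n (i : 'I_n) K (f f' : point n -> R) : 0 < c ->
  measurable_fun setT f' ->
  (forall t x, is_derive x (1 : R) (fun y => f (upd i t y)) (f' (upd i t x))) ->
  (forall t, continuous (fun y => f' (upd i t y))) ->
  (forall t, `|f t| <= K * ngauss c t) -> (forall t, `|f' t| <= K * ngauss c t) ->
  \int[leb n]_t f' t = 0.
Proof.
move=> c0; elim: n i K f f' => [[]//|n IHn] i K f f' mf' ff' cf' fK f'K.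
have intf' := integrable_gauss_bound c0 mf' f'K.
have mf'c : measurable_fun setT (f' \o @cons_pair R n).
  by apply: measurableT_comp => //; exact: measurable_cons_pair.
have intc : (mu \x leb n)%E.-integrable setT ((EFin \o f') \o @cons_pair R n).
  have gi : (mu \x leb n)%E.-integrable setT
      (fun p => (K%:E * (gauss c p.1 * ngauss c p.2)%:E)%E).
    apply: integrableZl => //; apply: integrable_tensor.
      exact: integrable_gauss.
    exact: integrable_ngauss.
  apply: le_integrable gi => //; first exact/measurable_EFinP.
  move=> [x t] _; rewrite /= lee_fin (le_trans (f'K _)) // ngauss_cons.
  exact: ler_norm.
have mx x : measurable_fun setT (fun t => f' (cons_pair (x, t))).
  by apply: measurableT_comp mf'c _; exact: measurable_pair1.
have mt t : measurable_fun setT (fun x => f' (cons_pair (x, t))).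
  by apply: measurableT_comp mf'c _; exact: measurable_pair2.
have mf'E : measurable_fun setT (EFin \o f') by exact/measurable_EFinP.
rewrite /Rintegral (integral_lebesgue_tupleS mf'E intc).
case: (unliftP ord0 i) ff' cf' => [j ->|->] ff' cf'.
- rewrite -integral12_prod_meas1 // /fubini_F integral0_eq // => x _.
  have intx : (leb n).-integrable setT (EFin \o (fun t => f' (cons_pair (x, t)))).
    apply: (@integrable_gauss_bound c (K * gauss c x)) => //.
    by move=> t; rewrite -mulrA -ngauss_cons.
  rewrite /= -EFin_Rintegral //; congr EFin.
  apply: (IHn j (K * gauss c x) (fun t => f (cons_pair (x, t)))) => //.
  + by move=> t y; have := ff' (cons_pair (x, t)) y; rewrite upd_consS;
      under eq_fun do rewrite upd_consS.
  + by move=> t; have := cf' (cons_pair (x, t)); under eq_fun do rewrite upd_consS.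
  + by move=> t; rewrite -mulrA -ngauss_cons.
  + by move=> t; rewrite -mulrA -ngauss_cons.
- rewrite -integral21_prod_meas1 // /fubini_G integral0_eq // => t _.
  have b g : (forall t, `|g t| <= K * ngauss c t) ->
      forall x, `|g (cons_pair (x, t))| <= K * ngauss c t * gauss c x.
    by move=> gK x; rewrite (le_trans (gK _)) // ngauss_cons mulrA mulrAC.
  rewrite -EFin_Rintegral; last first.
    apply: (@integrable_gauss_line _ c (K * ngauss c t)) => //; exact: b.
  congr EFin.
  apply: (@integral_derivative_line _ c (K * ngauss c t) (fun x => f (cons_pair (x, t)))) => //.
  + by move=> x; have := ff' (cons_pair (0, t)) x; rewrite upd_cons0;
      under eq_fun do rewrite upd_cons0.
  + by have := cf' (cons_pair (0, t)); under eq_fun do rewrite upd_cons0.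
  + exact: b.
  + exact: b.
Qed.

End GaussianTuple.

(** * Derivatives of complex functions of a real variable *)

Section ComplexCalculus.
Variable R : realType.
Local Notation C := R[i].
Local Notation re := (@complex.Re R).
Local Notation im := (@complex.Im R).
Implicit Types (z w : C) (x : R).

Lemma complex_ReD z w : re (z + w) = re z + re w.
Proof. by case: z; case: w. Qed.

Lemma complex_ImD z w : im (z + w) = im z + im w.
Proof. by case: z; case: w. Qed.

Lemma complex_ReN z : re (- z) = - re z.
Proof. by case: z. Qed.

Lemma complex_ReM z w : re (z * w) =
  re z * re w - im z * im w.
Proof. by case: z; case: w. Qed.

Lemma complex_ImM z w : im (z * w) =
  re z * im w + im z * re w.
Proof. by case: z; case: w. Qed.

Lemma complex_eta z : z = re z +i* im z.
Proof. by case: z. Qed.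

(** The l1 norm, a real-valued norm that bounds both components. *)
Definition norm1 z : R := `|re z| + `|im z|.

Lemma norm1_ge0 z : 0 <= norm1 z.
Proof. by rewrite addr_ge0. Qed.

Lemma normRe_le z : `|re z| <= norm1 z.
Proof. by rewrite lerDl. Qed.

Lemma normIm_le z : `|im z| <= norm1 z.
Proof. by rewrite lerDr. Qed.

Lemma norm1D z w : norm1 (z + w) <= norm1 z + norm1 w.
Proof. by rewrite /norm1 complex_ReD complex_ImD addrACA lerD // ler_normD. Qed.

Lemma norm1M z w : norm1 (z * w) <= norm1 z * norm1 w.
Proof.
rewrite /norm1 complex_ReM complex_ImM mulrDl !mulrDr -!normrM.
apply: le_trans (lerD (ler_normB _ _) (ler_normD _ _)) _.
by lra.
Qed.

Lemma norm1_expC z : norm1 (expC z) <= 2 * expR (re z).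
Proof.
rewrite /expC /norm1 complex_ReM complex_ImM /= !mul0r subr0 addr0 !normrM (ger0_norm (expR_ge0 _)).
rewrite -mulrDr mulrC ler_wpM2r ?expR_ge0 //.
by rewrite lerD // ler_norml ?cos_geN1 ?cos_le1 ?sin_geN1 ?sin_le1.
Qed.

(** Differentiability over the reals, component by component. *)
Definition cderive (g : R -> C) x (d : C) : Prop :=
  is_derive x (1 : R) (re \o g) (re d) /\
  is_derive x (1 : R) (im \o g) (im d).

Lemma cderive_eq (g : R -> C) x a b : cderive g x a -> a = b -> cderive g x b.
Proof. by move=> ? <-. Qed.

Lemma cderive_cst z x : cderive (fun=> z) x 0.
Proof. by split; exact: is_derive_cst. Qed.

Lemma cderive_real (g : R -> R) x d : is_derive x (1 : R) g d ->
  cderive (fun y => (g y)%:C) x d%:C.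
Proof. by move=> gd; split => //; exact: is_derive_cst. Qed.

Lemma cderiveD (f g : R -> C) x a b : cderive f x a -> cderive g x b ->
  cderive (fun y => f y + g y) x (a + b).
Proof.
move=> [fr fi] [gr gi]; split.
  rewrite complex_ReD (_ : _ \o _ = (re \o f) \+ (re \o g)) //.
    exact: is_deriveD.
  by apply/funext => y /=; rewrite complex_ReD.
rewrite complex_ImD (_ : _ \o _ = (im \o f) \+ (im \o g)) //.
  exact: is_deriveD.
by apply/funext => y /=; rewrite complex_ImD.
Qed.

Lemma cderiveM (f g : R -> C) x a b : cderive f x a -> cderive g x b ->
  cderive (fun y => f y * g y) x (a * g x + f x * b).
Proof.
move=> [fr fi] [gr gi]; split.
  rewrite (_ : _ \o _ = (re \o f) * (re \o g) -
    (im \o f) * (im \o g)); last first.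
    by apply/funext => y; rewrite !fctE /= complex_ReM.
  apply: (is_derive_eq (is_deriveB (is_deriveM fr gr) (is_deriveM fi gi))).
  by rewrite complex_ReD !complex_ReM /GRing.scale /=; ring.
rewrite (_ : _ \o _ = (re \o f) * (im \o g) +
    (im \o f) * (re \o g)); last first.
  by apply/funext => y; rewrite !fctE /= complex_ImM.
apply: (is_derive_eq (is_deriveD (is_deriveM fr gi) (is_deriveM fi gr))).
by rewrite complex_ImD !complex_ImM /GRing.scale /=; ring.
Qed.

Lemma cderiveN (f : R -> C) x a : cderive f x a -> cderive (fun y => - f y) x (- a).
Proof.
move=> fa; have := cderiveM (cderive_cst (-1) x) fa.
by rewrite mul0r add0r mulN1r; under eq_fun do rewrite mulN1r.
Qed.

Lemma cderiveZ (f : R -> C) x a z : cderive f x a ->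
  cderive (fun y => z * f y) x (z * a).
Proof. by move=> fa; have := cderiveM (cderive_cst z x) fa; rewrite mul0r add0r. Qed.

Lemma cderive_sum (I : Type) (r : seq I) (P : pred I) (F : I -> R -> C) x d :
  (forall i, P i -> cderive (F i) x (d i)) ->
  cderive (fun y => \sum_(i <- r | P i) F i y) x (\sum_(i <- r | P i) d i).
Proof.
move=> Fd; elim: r => [|i r IHr].
  by rewrite big_nil; under eq_fun do rewrite big_nil; exact: cderive_cst.
rewrite big_cons; under eq_fun do rewrite big_cons.
by case: ifP => // Pi; apply: cderiveD => //; exact: Fd.
Qed.

Lemma cderive_expC (g : R -> C) x d : cderive g x d ->
  cderive (fun y => expC (g y)) x (d * expC (g x)).
Proof.
move=> [gr gi].
have e : is_derive x (1 : R) (fun y => expR (re (g y)))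
    (expR (re (g x)) * re d) by exact: is_derive1_comp.
have c : is_derive x (1 : R) (fun y => cos (im (g y)))
    (- sin (im (g x)) * im d) by exact: is_derive1_comp.
have s : is_derive x (1 : R) (fun y => sin (im (g y)))
    (cos (im (g x)) * im d) by exact: is_derive1_comp.
have cs : cderive (fun y => cos (im (g y)) +i* sin (im (g y))) x
   ((- sin (im (g x)) * im d) +i* (cos (im (g x)) * im d)).
  by split.
apply: (cderive_eq (cderiveM (cderive_real e) cs)); rewrite /expC.
apply/eqP; rewrite eq_complex; apply/andP; split; apply/eqP.
  by rewrite !(complex_ReD, complex_ReM, complex_ImM) /=; ring.
by rewrite !(complex_ImD, complex_ReM, complex_ImM) /=; ring.
Qed.

Lemma cderive_continuous (g : R -> C) d : (forall x, cderive g x (d x)) ->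
  continuous (re \o g) /\ continuous (im \o g).
Proof.
move=> gd; split=> x; apply/differentiable_continuous/derivable1_diffP;
  by case: (gd x) => ? ?; exact: ex_derive.
Qed.

End ComplexCalculus.

(** * Integration by parts against a complex Gaussian *)

Section ComplexIntegral.
Variables (R : realType) (n : nat).
Local Open Scope classical_set_scope.
Local Notation C := R[i].
Local Notation re := (@complex.Re R).
Local Notation im := (@complex.Im R).
Local Notation point := (n.-tuple (measurableTypeR R)).
Local Notation leb := (lebesgue_tuple R n).
Implicit Types (f g q : point -> C) (t : point) (c K : R) (i : 'I_n).

Definition cmeasurable f : Prop :=
  measurable_fun setT (re \o f) /\ measurable_fun setT (im \o f).

Lemma cmeasurable_cst (z : C) : cmeasurable (fun=> z).
Proof. by split; exact: measurable_cst. Qed.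

Lemma cmeasurableD f g : cmeasurable f -> cmeasurable g ->
  cmeasurable (fun t => f t + g t).
Proof.
move=> [fr fi] [gr gi]; split.
  rewrite (_ : _ \o _ = fun t => re (f t) + re (g t)); last by apply/funext => t /=; rewrite complex_ReD.
  exact: measurable_funD.
rewrite (_ : _ \o _ = fun t => im (f t) + im (g t)); last by apply/funext => t /=; rewrite complex_ImD.
exact: measurable_funD.
Qed.

Lemma cmeasurableM f g : cmeasurable f -> cmeasurable g ->
  cmeasurable (fun t => f t * g t).
Proof.
move=> [fr fi] [gr gi]; split.
  rewrite (_ : _ \o _ = fun t => re (f t) * re (g t) - im (f t) * im (g t)); last first.
    by apply/funext => t /=; rewrite complex_ReM.
  by apply: measurable_funB; exact: measurable_funM.
rewrite (_ : _ \o _ = fun t => re (f t) * im (g t) + im (f t) * re (g t)); last first.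
  by apply/funext => t /=; rewrite complex_ImM.
by apply: measurable_funD; exact: measurable_funM.
Qed.

Lemma cmeasurable_expC f : cmeasurable f -> cmeasurable (fun t => expC (f t)).
Proof.
move=> [fr fi].
have e : measurable_fun setT (fun t => expR (re (f t))) by exact: measurableT_comp.
have c : measurable_fun setT (fun t => cos (im (f t))).
  apply: measurableT_comp => //; apply: continuous_measurable_fun; exact: continuous_cos.
have s : measurable_fun setT (fun t => sin (im (f t))).
  apply: measurableT_comp => //; apply: continuous_measurable_fun; exact: continuous_sin.
split.
  rewrite (_ : _ \o _ = fun t => expR (re (f t)) * cos (im (f t))); last first.
    by apply/funext => t; rewrite /comp /expC complex_ReM /= mul0r subr0.
  exact: measurable_funM.
rewrite (_ : _ \o _ = fun t => expR (re (f t)) * sin (im (f t))); last first.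
  by apply/funext => t; rewrite /comp /expC complex_ImM /= mul0r addr0.
exact: measurable_funM.
Qed.

(** A space of integrable functions that is closed under linear combinations
    and fixes the rate c of decay. *)
Definition gauss_bounded c f : Prop :=
  cmeasurable f /\ exists K, forall t, norm1 (f t) <= K * ngauss c t.

Lemma gauss_boundedD c f g : gauss_bounded c f -> gauss_bounded c g ->
  gauss_bounded c (fun t => f t + g t).
Proof.
move=> [mf [K fK]] [mg [M gM]]; split; first exact: cmeasurableD.
exists (K + M) => t; rewrite mulrDl; apply: le_trans (norm1D _ _) _.
exact: lerD.
Qed.

Lemma gauss_boundedZ c z f : gauss_bounded c f -> gauss_bounded c (fun t => z * f t).
Proof.
move=> [mf [K fK]]; split; first by apply: cmeasurableM => //; exact: cmeasurable_cst.
exists (norm1 z * K) => t; apply: le_trans (norm1M _ _) _.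
by rewrite -mulrA ler_wpM2l // norm1_ge0.
Qed.

Lemma gauss_bounded_sum c (I : Type) (r : seq I) (F : I -> point -> C) :
  (forall k, gauss_bounded c (F k)) -> gauss_bounded c (fun t => \sum_(k <- r) F k t).
Proof.
move=> Fb; elim: r => [|k r IHr].
  under eq_fun do rewrite big_nil; split; first exact: cmeasurable_cst.
  by exists 0 => t; rewrite /norm1 /= normr0 addr0 mul0r.
by under eq_fun do rewrite big_cons; exact: gauss_boundedD.
Qed.

Lemma gauss_bounded_integrable c f : 0 < c -> gauss_bounded c f ->
  leb.-integrable setT (EFin \o (re \o f)) /\ leb.-integrable setT (EFin \o (im \o f)).
Proof.
move=> c0 [[mr mi] [K fK]]; split.
  apply: integrable_gauss_bound c0 mr _ => t.
  exact: le_trans (normRe_le _) (fK t).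
apply: integrable_gauss_bound c0 mi _ => t.
exact: le_trans (normIm_le _) (fK t).
Qed.

Definition cintegral f : C := (\int[leb]_t re (f t)) +i* (\int[leb]_t im (f t)).

Lemma cintegralD c f g : 0 < c -> gauss_bounded c f -> gauss_bounded c g ->
  cintegral (fun t => f t + g t) = cintegral f + cintegral g.
Proof.
move=> c0 /(gauss_bounded_integrable c0)[fr fi] /(gauss_bounded_integrable c0)[gr gi].
rewrite /cintegral; under eq_Rintegral do rewrite complex_ReD.
under [X in _ +i* X]eq_Rintegral do rewrite complex_ImD.
by rewrite !RintegralD.
Qed.

Lemma cintegralZ c z f : 0 < c -> gauss_bounded c f ->
  cintegral (fun t => z * f t) = z * cintegral f.
Proof.
move=> c0 /(gauss_bounded_integrable c0)[fr fi].
rewrite /cintegral; under eq_Rintegral do rewrite complex_ReM.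
under [X in _ +i* X]eq_Rintegral do rewrite complex_ImM.
have Z a (h : point -> R) : leb.-integrable setT (EFin \o h) ->
    leb.-integrable setT (EFin \o (fun t => a * h t)).
  move=> hi; rewrite /comp; under eq_fun do rewrite EFinM; exact: integrableZl.
rewrite RintegralB ?RintegralD //; try exact: Z.
by rewrite !RintegralZl //; case: z.
Qed.

Lemma cintegral_sum c (I : Type) (r : seq I) (F : I -> point -> C) : 0 < c ->
  (forall k, gauss_bounded c (F k)) ->
  cintegral (fun t => \sum_(k <- r) F k t) = \sum_(k <- r) cintegral (F k).
Proof.
move=> c0 Fb; elim: r => [|k r IHr].
  rewrite big_nil /cintegral; under eq_Rintegral do rewrite big_nil.
  under [X in _ +i* X]eq_Rintegral do rewrite big_nil.
  by rewrite /= /Rintegral !integral0.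
rewrite big_cons -IHr -(cintegralD c0) //; last exact: gauss_bounded_sum.
by congr cintegral; apply/funext => t; rewrite big_cons.
Qed.

(** The polynomial functions, as the closure of the constants and the
    coordinates: measurability, growth and the existence of partial derivatives
    follow by induction. *)
Inductive polyf : (point -> C) -> Prop :=
| polyf_cst z : polyf (fun=> z)
| polyf_coord i : polyf (fun t => (tnth t i : R)%:C)
| polyfD f g : polyf f -> polyf g -> polyf (fun t => f t + g t)
| polyfM f g : polyf f -> polyf g -> polyf (fun t => f t * g t).

Lemma polyf_sum (I : Type) (r : seq I) (P : pred I) (F : I -> point -> C) :
  (forall k, P k -> polyf (F k)) -> polyf (fun t => \sum_(k <- r | P k) F k t).
Proof.
move=> Fp; elim: r => [|k r IHr].
  by under eq_fun do rewrite big_nil; exact: polyf_cst.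
under eq_fun do rewrite big_cons.
by move: (Fp k); case: (P k) => // Fk; apply: polyfD => //; exact: Fk.
Qed.

Lemma polyf_measurable f : polyf f -> cmeasurable f.
Proof.
elim=> [z|i|{}f g _ mf _ mg|{}f g _ mf _ mg].
- exact: cmeasurable_cst.
- by split; [exact: measurable_coord|exact: measurable_cst].
- exact: cmeasurableD.
- exact: cmeasurableM.
Qed.

(** A polynomial grows more slowly than every Gaussian; a product uses one half of
    the exponent for each factor. *)
Lemma polyf_subgauss f : polyf f -> forall e, 0 < e ->
  exists2 K, 0 <= K & forall t, norm1 (f t) <= K * ngauss (- e) t.
Proof.
elim=> [z|i|{}f g _ hf _ hg|{}f g _ hf _ hg] e e0.
- exists (norm1 z) => [|t]; first exact: norm1_ge0.
  rewrite ler_peMr ?norm1_ge0 // /ngauss mulNr opprK -expR0 ler_expR.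
  by rewrite mulr_ge0 ?sqnorm_ge0 // ltW.
- exists (1 + e^-1) => [|t]; first by rewrite addr_ge0 // invr_ge0 ltW.
  rewrite /norm1 /= normr0 addr0.
  set x := tnth t i; have x2 : x ^+ 2 <= sqnorm t.
    rewrite /sqnorm (bigD1 i) //= lerDl; apply: sumr_ge0 => j _; exact: sqr_ge0.
  have h1 : `|x| <= 1 + x ^+ 2.
    have : 0 <= (`|x| - 1) ^+ 2 by exact: sqr_ge0.
    rewrite sqrrB1 real_normK ?num_real //.
    have : 0 <= `|x| by []. lra.
  have h2 : 1 + e * sqnorm t <= ngauss (- e) t.
    by rewrite /ngauss mulNr opprK expR_ge1Dx.
  apply: (le_trans h1); apply: le_trans (_ : _ <= (1 + e^-1) * (1 + e * sqnorm t)) _.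
    have -> : (1 + e^-1) * (1 + e * sqnorm t) = 1 + e * sqnorm t + e^-1 + sqnorm t.
      by field; rewrite gt_eqF.
    have ei0 : 0 < e^-1 by rewrite invr_gt0.
    have s0 := sqnorm_ge0 t; have es0 : 0 <= e * sqnorm t by rewrite mulr_ge0 // ltW.
    lra.
  by rewrite ler_wpM2l // addr_ge0 // ltW // invr_gt0.
- have [K K0 fK] := hf e e0; have [M M0 gM] := hg e e0.
  exists (K + M) => [|t]; first exact: addr_ge0.
  by rewrite mulrDl (le_trans (norm1D _ _)) // lerD.
- have e20 : 0 < e / 2 by rewrite divr_gt0.
  have [K K0 fK] := hf _ e20; have [M M0 gM] := hg _ e20.
  exists (K * M) => [|t]; first exact: mulr_ge0.
  rewrite (le_trans (norm1M _ _)) //.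
  have -> : ngauss (- e) t = ngauss (- (e / 2)) t * ngauss (- (e / 2)) t.
    by rewrite /ngauss -expRD; congr expR; field.
  by rewrite mulrACA ler_pM ?norm1_ge0.
Qed.

Definition coercive c q : Prop := forall t, c * sqnorm t <= re (q t).

(** Half of the decay of the weight absorbs the growth of the polynomial. *)
Lemma polyf_gauss_bounded c f q : 0 < c -> polyf f -> polyf q -> coercive c q ->
  gauss_bounded (c / 2) (fun t => f t * expC (- q t)).
Proof.
move=> c0 pf pq cq; split.
  apply: cmeasurableM; first exact: polyf_measurable.
  apply: cmeasurable_expC; under eq_fun do rewrite -mulN1r.
  by apply: cmeasurableM; [exact: cmeasurable_cst|exact: polyf_measurable].
have c20 : 0 < c / 2 by rewrite divr_gt0.
have [K K0 fK] := polyf_subgauss pf c20.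
exists (K * 2) => t; apply: le_trans (norm1M _ _) _.
apply: le_trans (_ : _ <= (K * ngauss (- (c / 2)) t) * (2 * ngauss c t)) _.
  rewrite ler_pM ?norm1_ge0 //; apply: le_trans (norm1_expC _) _.
  by rewrite ler_wpM2l // ler_expR complex_ReN lerN2.
rewrite mulrACA /ngauss -expRD le_eqVlt; apply/orP; left; apply/eqP.
by congr (_ * expR _); field.
Qed.

Definition partial i f f' : Prop :=
  forall t x, cderive (fun y => f (upd i t y)) x (f' (upd i t x)).

Lemma partial_cst i z : partial i (fun=> z) (fun=> 0).
Proof. by move=> t x; exact: cderive_cst. Qed.

Lemma partial_coord i j :
  partial i (fun t => (tnth t j : R)%:C) (fun=> (i == j)%:R).
Proof.
move=> t x; under eq_fun do rewrite tnth_mktuple.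
rewrite (eq_sym i j); case: (j == i); last exact: cderive_cst.
apply: (cderive_eq (cderive_real (is_derive_id x (1 : R)))).
by [].
Qed.

Lemma partialD i f f' g g' : partial i f f' -> partial i g g' ->
  partial i (fun t => f t + g t) (fun t => f' t + g' t).
Proof. by move=> pf pg t x; exact: cderiveD. Qed.

Lemma partialM i f f' g g' : partial i f f' -> partial i g g' ->
  partial i (fun t => f t * g t) (fun t => f' t * g t + f t * g' t).
Proof. by move=> pf pg t x; have := cderiveM (pf t x) (pg t x). Qed.

Lemma polyf_partial i f : polyf f -> exists2 f', polyf f' & partial i f f'.
Proof.
elim=> [z|j|{}f g pf [f' pf' ff'] pg [g' pg' gg']|{}f g pf [f' pf' ff'] pg [g' pg' gg']].
- by exists (fun=> 0); [exact: polyf_cst|exact: partial_cst].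
- by exists (fun=> (i == j)%:R); [exact: polyf_cst|exact: partial_coord].
- by eexists; [exact: (polyfD pf' pg')|exact: partialD].
- eexists; last exact: (partialM ff' gg').
  by apply: polyfD; exact: polyfM.
Qed.

Lemma partial_gaussian i f f' q q' : partial i f f' -> partial i q q' ->
  partial i (fun t => f t * expC (- q t)) (fun t => (f' t - f t * q' t) * expC (- q t)).
Proof.
move=> pf pq t x.
apply: (cderive_eq (cderiveM (pf t x) (cderive_expC (cderiveN (pq t x))))).
by rewrite mulrBl mulNr mulrN mulrA.
Qed.

(** The second derivative g' serves only to give the continuity of f' along the
    i-th coordinate, which the fundamental theorem of calculus asks for. *)
Lemma cintegral_partial c i f f' g' : 0 < c -> gauss_bounded c f ->
  gauss_bounded c f' -> partial i f f' -> partial i f' g' -> cintegral f' = 0.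
Proof.
move=> c0 [_ [K fK]] [[mr mi] [M f'M]] pf pf'.
have ngK a b t : a <= b -> a * ngauss c t <= b * ngauss c t.
  by move=> ab; rewrite ler_wpM2r // expR_ge0.
have leK t : norm1 (f t) <= Num.max K M * ngauss c t.
  by rewrite (le_trans (fK t)) // ngK // le_max lexx.
have leM t : norm1 (f' t) <= Num.max K M * ngauss c t.
  by rewrite (le_trans (f'M t)) // ngK // le_max lexx orbT.
have re0 : \int[leb]_t re (f' t) = 0.
  apply: (@integral_partial _ c n i (Num.max K M) (re \o f) (re \o f')) => //.
  - by move=> t x; case: (pf t x).
  - by move=> t; have [] := cderive_continuous (pf' t).
  - by move=> t; exact: le_trans (normRe_le _) (leK t).
  - by move=> t; exact: le_trans (normRe_le _) (leM t).
have im0 : \int[leb]_t im (f' t) = 0.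
  apply: (@integral_partial _ c n i (Num.max K M) (im \o f) (im \o f')) => //.
  - by move=> t x; case: (pf t x).
  - by move=> t; have [] := cderive_continuous (pf' t).
  - by move=> t; exact: le_trans (normIm_le _) (leK t).
  - by move=> t; exact: le_trans (normIm_le _) (leM t).
by rewrite /cintegral re0 im0.
Qed.

Lemma cintegral_ibp c i f f' q q' : 0 < c -> coercive c q ->
  polyf f -> polyf f' -> polyf q -> polyf q' -> partial i f f' -> partial i q q' ->
  cintegral (fun t => f' t * expC (- q t)) =
  cintegral (fun t => f t * q' t * expC (- q t)).
Proof.
move=> c0 cq pf pf' pq pq' ff' qq'.
have c20 : 0 < c / 2 by rewrite divr_gt0.
have ph : polyf (fun t => f' t - f t * q' t).
  under eq_fun do rewrite -mulN1r.
  by apply: polyfD => //; apply: polyfM (polyf_cst _) _; exact: polyfM.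
have [g pg hg] := polyf_partial i ph.
have gb h : polyf h -> gauss_bounded (c / 2) (fun t => h t * expC (- q t)).
  by move=> ?; exact: polyf_gauss_bounded.
have := cintegral_partial c20 (gb _ pf) (gb _ ph) (partial_gaussian ff' qq')
  (partial_gaussian hg qq').
have -> : (fun t => (f' t - f t * q' t) * expC (- q t)) =
   (fun t => f' t * expC (- q t) + -1 * (f t * q' t * expC (- q t))).
  by apply/funext => t; rewrite mulrBl mulN1r.
rewrite (cintegralD c20 (gb _ pf')); last by apply/gauss_boundedZ/gb/polyfM.
rewrite (cintegralZ _ c20); last by apply/gb/polyfM.
by rewrite mulN1r => /eqP; rewrite subr_eq0 => /eqP.
Qed.

End ComplexIntegral.

(** * Wirtinger derivatives and the bosonic action *)

Section PolynomialForms.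
Variables (R : realType) (L : finType).
Local Notation C := R[i].
Local Notation point := (#|L|.*2.-tuple (measurableTypeR R)).
Local Notation ext := (extalg C #|L|.*2).
Implicit Types (f g : point -> C) (F G H : point -> ext) (x y z : L) (t : point).

Definition cphi x t : C := tnth t (uv_index x false) +i* tnth t (uv_index x true).
Definition cphibar x t : C := tnth t (uv_index x false) -i* tnth t (uv_index x true).

Lemma imaginaryE : 'i = 0 +i* 1 :> C. Proof. by []. Qed.

Lemma cphiE x : cphi x = fun t =>
  (tnth t (uv_index x false) : R)%:C + 'i * (tnth t (uv_index x true) : R)%:C.
Proof.
apply/funext => t; apply/eqP; rewrite imaginaryE eq_complex /=.
by apply/andP; split; apply/eqP; ring.
Qed.

Lemma cphibarE x : cphibar x = fun t =>
  (tnth t (uv_index x false) : R)%:C + - 'i * (tnth t (uv_index x true) : R)%:C.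
Proof.
apply/funext => t; apply/eqP; rewrite imaginaryE eq_complex /=.
by apply/andP; split; apply/eqP; ring.
Qed.

Ltac polyf_tac := repeat first [exact: polyf_coord | exact: polyf_cst | assumption
  | apply: polyfD | apply: polyfM].

Lemma polyf_phi x : polyf (cphi x).
Proof.
by rewrite cphiE; polyf_tac.
Qed.

Lemma polyf_phibar x : polyf (cphibar x).
Proof.
by rewrite cphibarE; polyf_tac.
Qed.

(** The Wirtinger derivative (d/du - i d/dv)/2 in phi_y, as a relation so that the
    Leibniz rules also propagate polynomiality. *)
Definition wirtinger y f f' : Prop :=
  [/\ polyf f, polyf f' & exists fu fv, [/\ polyf fu, polyf fv,
    partial (uv_index y false) f fu, partial (uv_index y true) f fv &
    f' = fun t => 2^-1 * (fu t + - 'i * fv t)]].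

Lemma wirtinger_intro y f fu fv f' : polyf f -> polyf fu -> polyf fv ->
  partial (uv_index y false) f fu -> partial (uv_index y true) f fv ->
  f' = (fun t => 2^-1 * (fu t + - 'i * fv t)) -> wirtinger y f f'.
Proof.
move=> pf pu pv hu hv ->; split=> //; last by exists fu, fv.
polyf_tac.
Qed.

Lemma wirtinger_cst y (a : C) : wirtinger y (fun=> a) (fun=> 0).
Proof.
apply: (@wirtinger_intro _ _ (fun=> 0) (fun=> 0)); try exact: polyf_cst; try exact: partial_cst.
by apply/funext => t; rewrite mulr0 addr0 mulr0.
Qed.

Lemma wirtinger_lin y x (a : C) :
  wirtinger y (fun t => (tnth t (uv_index x false) : R)%:C +
                   a * (tnth t (uv_index x true) : R)%:C)
    (fun=> 2^-1 * (x == y)%:R * (1 - 'i * a)).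
Proof.
have P i : partial i (fun t => (tnth t (uv_index x false) : R)%:C +
                   a * (tnth t (uv_index x true) : R)%:C)
   (fun t => (i == uv_index x false)%:R +
     (0 * (tnth t (uv_index x true) : R)%:C + a * (i == uv_index x true)%:R)).
  apply: partialD; first exact: partial_coord.
  by apply: partialM; [exact: partial_cst|exact: partial_coord].
apply: (wirtinger_intro _ _ _ (P _) (P _)).
- polyf_tac.
- polyf_tac.
- polyf_tac.
apply/funext => t; rewrite !uv_index_inj !mul0r !add0r !andbT !andbF (eq_sym y).
by rewrite [false%:R]mulr0n mulr0 addr0 add0r; case: (x == y); rewrite ?mulr1n ?mulr0n; ring.
Qed.

Lemma wirtinger_phi y x : wirtinger y (cphi x) (fun=> (x == y)%:R).
Proof.
rewrite cphiE; have := wirtinger_lin y x 'i.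
have -> : 2^-1 * (x == y)%:R * (1 - 'i * 'i) = (x == y)%:R :> C.
  by rewrite -expr2 sqrCi opprK mulrAC mulVf ?mul1r // (_ : 1 + 1 = 2%:R) // pnatr_eq0.
exact.
Qed.

Lemma wirtinger_phibar y x : wirtinger y (cphibar x) (fun=> 0).
Proof.
rewrite cphibarE; have := wirtinger_lin y x (- 'i).
have -> : 2^-1 * (x == y)%:R * (1 - 'i * - 'i) = 0 :> C.
  by rewrite mulrN -expr2 sqrCi opprK subrr mulr0.
exact.
Qed.

Lemma wirtingerD y f f' g g' : wirtinger y f f' -> wirtinger y g g' ->
  wirtinger y (fun t => f t + g t) (fun t => f' t + g' t).
Proof.
move=> [pf _ [fu [fv [pfu pfv hfu hfv ->]]]] [pg _ [gu [gv [pgu pgv hgu hgv ->]]]].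
apply: (wirtinger_intro _ _ _ (partialD hfu hgu) (partialD hfv hgv));
  try exact: polyfD.
by apply/funext => t; ring.
Qed.

Lemma wirtingerM y f f' g g' : wirtinger y f f' -> wirtinger y g g' ->
  wirtinger y (fun t => f t * g t) (fun t => f' t * g t + f t * g' t).
Proof.
move=> [pf _ [fu [fv [pfu pfv hfu hfv ->]]]] [pg _ [gu [gv [pgu pgv hgu hgv ->]]]].
apply: (wirtinger_intro _ _ _ (partialM hfu hgu) (partialM hfv hgv)).
- exact: polyfM.
- by apply: polyfD; exact: polyfM.
- by apply: polyfD; exact: polyfM.
by apply/funext => t; ring.
Qed.

Lemma wirtingerZ y (a : C) f f' : wirtinger y f f' ->
  wirtinger y (fun t => a * f t) (fun t => a * f' t).
Proof.
move=> hf; have := wirtingerM (wirtinger_cst y a) hf.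
by under [X in wirtinger _ _ X -> _]eq_fun do rewrite mul0r add0r.
Qed.

Lemma wirtinger_sum y (I : Type) (r : seq I) (P : pred I) (f f' : I -> point -> C) :
  (forall k, P k -> wirtinger y (f k) (f' k)) ->
  wirtinger y (fun t => \sum_(k <- r | P k) f k t) (fun t => \sum_(k <- r | P k) f' k t).
Proof.
move=> ff'; elim: r => [|k r IHr].
  under eq_fun do rewrite big_nil; under [X in wirtinger _ _ X]eq_fun do rewrite big_nil.
  exact: wirtinger_cst.
under eq_fun do rewrite big_cons; under [X in wirtinger _ _ X]eq_fun do rewrite big_cons.
by move: (ff' k); case: (P k) => // ffk; apply: wirtingerD => //; exact: ffk.
Qed.

Definition bos_action (A : L -> L -> C) t : C :=
  \sum_x \sum_z A x z * (cphi x t * cphibar z t).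

Lemma wirtinger_action A y :
  wirtinger y (bos_action A) (fun t => \sum_z A y z * cphibar z t).
Proof.
have W : wirtinger y (bos_action A) (fun t => \sum_x \sum_z
    A x z * ((x == y)%:R * cphibar z t + cphi x t * 0)).
  apply: wirtinger_sum => x _; apply: wirtinger_sum => z _; apply: wirtingerZ.
  exact: wirtingerM (wirtinger_phi _ _) (wirtinger_phibar _ _).
congr wirtinger: W; apply/funext => t; rewrite (bigD1 y) //= eqxx [X in _ + X]big1 ?addr0.
  by apply: eq_bigr => z _; rewrite mul1r mulr0 addr0.
move=> x /negPf xy; apply: big1 => z _.
by rewrite xy mul0r mulr0 addr0 mulr0.
Qed.

Lemma polyf_action A : polyf (bos_action A).
Proof.
apply: polyf_sum => x _; apply: polyf_sum => z _; apply: polyfM; first exact: polyf_cst.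
by apply: polyfM; [exact: polyf_phi|exact: polyf_phibar].
Qed.

Section Weight.
Variables (A : L -> L -> C) (c : R).
Hypotheses (c_gt0 : 0 < c) (A_coercive : coercive c (bos_action A)).

Definition bos_integral f : C := cintegral (fun t => f t * expC (- bos_action A t)).

Lemma bos_bounded f : polyf f ->
  gauss_bounded (c / 2) (fun t => f t * expC (- bos_action A t)).
Proof. by move=> pf; apply: polyf_gauss_bounded => //; exact: polyf_action. Qed.

Let c2_gt0 : 0 < c / 2. Proof. by rewrite divr_gt0. Qed.

Lemma bos_integralD f g : polyf f -> polyf g ->
  bos_integral (fun t => f t + g t) = bos_integral f + bos_integral g.
Proof.
move=> pf pg; rewrite -(cintegralD c2_gt0 (bos_bounded pf) (bos_bounded pg)).
by congr cintegral; apply/funext => t; rewrite mulrDl.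
Qed.

Lemma bos_integralZ (a : C) f : polyf f ->
  bos_integral (fun t => a * f t) = a * bos_integral f.
Proof.
move=> pf; rewrite -(cintegralZ _ c2_gt0 (bos_bounded pf)).
by congr cintegral; apply/funext => t; rewrite mulrA.
Qed.

Lemma bos_integral_sum (I : Type) (r : seq I) (f : I -> point -> C) :
  (forall k, polyf (f k)) ->
  bos_integral (fun t => \sum_(k <- r) f k t) = \sum_(k <- r) bos_integral (f k).
Proof.
move=> pf; rewrite -(cintegral_sum _ c2_gt0 (fun k => bos_bounded (pf k))).
by congr cintegral; apply/funext => t; rewrite mulr_suml.
Qed.

(** Integration by parts in u_y and in v_y, combined: the Wirtinger derivative of
    the action in phi_y is the y-th entry of A phibar. *)
Lemma bos_ibp y f f' : wirtinger y f f' ->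
  bos_integral f' = \sum_z A y z * bos_integral (fun t => cphibar z t * f t).
Proof.
move=> [pf _ [fu [fv [pfu pfv hfu hfv ->]]]].
have [pq pq' [qu [qv [pqu pqv hqu hqv q'E]]]] := wirtinger_action A y.
have pM g : polyf g -> polyf (fun t => - 'i * g t).
  by move=> ?; apply: polyfM; first exact: polyf_cst.
rewrite bos_integralZ ?bos_integralD ?bos_integralZ //; try by [apply: pM|apply: polyfD => //; exact: pM].
have -> : bos_integral fu = bos_integral (fun t => f t * qu t).
  exact: (cintegral_ibp c_gt0 A_coercive pf pfu pq pqu hfu hqu).
have -> : bos_integral fv = bos_integral (fun t => f t * qv t).
  exact: (cintegral_ibp c_gt0 A_coercive pf pfv pq pqv hfv hqv).
have pfq g : polyf g -> polyf (fun t => f t * g t) by exact: polyfM.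
have <- : bos_integral (fun t => 2^-1 * (f t * qu t + - 'i * (f t * qv t))) =
    2^-1 * (bos_integral (fun t => f t * qu t) +
            - 'i * bos_integral (fun t => f t * qv t)).
  by rewrite bos_integralZ ?bos_integralD ?bos_integralZ //; polyf_tac.
have <- : bos_integral (fun t => \sum_z A y z * (cphibar z t * f t)) =
    \sum_z A y z * bos_integral (fun t => cphibar z t * f t).
  rewrite bos_integral_sum => [|z].
    by apply: eq_bigr => z _; rewrite bos_integralZ //; polyf_tac; exact: polyf_phibar.
  by polyf_tac; exact: polyf_phibar.
congr bos_integral; apply/funext => t.
transitivity (f t * (2^-1 * (qu t + - 'i * qv t))); first by ring.
have /(congr1 (fun h => h t)) <- := q'E.
by rewrite mulr_sumr; apply: eq_bigr => z _; ring.
Qed.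

End Weight.
End PolynomialForms.

(** * The expectation of forms with polynomial coefficients *)

Section Expectation.
Variables (R : realType) (L : finType) (s : R[i]).
Local Notation C := R[i].
Local Notation point := (#|L|.*2.-tuple (measurableTypeR R)).
Local Notation ext := (extalg C #|L|.*2).
Local Notation top := [set: 'I_#|L|.*2]%SET.
Local Notation psi := (grass_psi (L := L) s).
Local Notation psibar := (grass_psibar (L := L) s).
Local Notation dpsi := (grass_dpsi (L := L) s).
Implicit Types (f g : point -> C) (F G H : point -> ext) (x y z : L) (t : point).

Lemma ext_mulE (e h : ext) S : (e * h) S = \sum_(T : {set 'I_#|L|.*2} | T \subset S)
    (-1) ^+ inversions T (S :\: T) * ((e T : C) * (h (S :\: T)%SET : C)).
Proof. by rewrite ffunE. Qed.

Definition polyform F : Prop := forall S, polyf (fun t => F t S : C).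

Lemma polyform_cst (e : ext) : polyform (fun=> e).
Proof. by move=> S; exact: polyf_cst. Qed.

Lemma polyformD F G : polyform F -> polyform G -> polyform (fun t => F t + G t).
Proof. by move=> pF pG S; under eq_fun do rewrite extDE; exact: polyfD. Qed.

Lemma polyformZ f F : polyf f -> polyform F -> polyform (fun t => f t *: F t).
Proof. by move=> pf pF S; under eq_fun do rewrite extZE; exact: polyfM. Qed.

Lemma polyformM F G : polyform F -> polyform G -> polyform (fun t => F t * G t).
Proof.
move=> pF pG S; under eq_fun do rewrite ext_mulE.
apply: polyf_sum => T _; apply: polyfM; first exact: polyf_cst.
by apply: polyfM; [exact: pF|exact: pG].
Qed.

(** The Wirtinger derivative in phi_y of the coefficients of a form. *)
Definition dform y F F' : Prop :=
  forall S, wirtinger y (fun t => F t S : C) (fun t => F' t S : C).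

Lemma dform_cst y (e : ext) : dform y (fun=> e) (fun=> 0).
Proof.
move=> S; have -> : (fun t : point => (0 : ext) S) = (fun=> 0).
  by apply/funext => t; rewrite ffunE.
exact: wirtinger_cst.
Qed.

Lemma dformD y F F' G G' : dform y F F' -> dform y G G' ->
  dform y (fun t => F t + G t) (fun t => F' t + G' t).
Proof.
move=> dF dG S; under eq_fun do rewrite extDE.
under [X in wirtinger _ _ X]eq_fun do rewrite extDE.
exact: wirtingerD.
Qed.

Lemma dformZ y f f' F F' : wirtinger y f f' -> dform y F F' ->
  dform y (fun t => f t *: F t) (fun t => f' t *: F t + f t *: F' t).
Proof.
move=> df dF S; under eq_fun do rewrite extZE; under [X in wirtinger _ _ X]eq_fun do rewrite extDE !extZE.
exact: wirtingerM.
Qed.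

Lemma dformM y F F' G G' : dform y F F' -> dform y G G' ->
  dform y (fun t => F t * G t) (fun t => F' t * G t + F t * G' t).
Proof.
move=> dF dG S; under eq_fun do rewrite ext_mulE.
have -> : (fun t => (F' t * G t + F t * G' t) S) = (fun t =>
    \sum_(T : {set 'I_#|L|.*2} | T \subset S) (-1) ^+ inversions T (S :\: T) *
    ((F' t T : C) * (G t (S :\: T)%SET : C) + (F t T : C) * (G' t (S :\: T)%SET : C))).
  apply/funext => t; rewrite extDE !ext_mulE -big_split.
  by apply: eq_bigr => T _; rewrite mulrDr.
apply: wirtinger_sum => T _; apply: wirtingerZ; exact: wirtingerM.
Qed.

Lemma dform_poly y F F' : dform y F F' -> polyform F /\ polyform F'.
Proof. by move=> dF; split=> S; case: (dF S). Qed.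

Section Weight.
Variables (A : L -> L -> C) (c : R).
Hypotheses (s_neq0 : s != 0) (c_gt0 : 0 < c) (A_coercive : coercive c (bos_action A)).

(** The integral of exp(-S_A) F, for a form F with polynomial coefficients. *)
Definition expect F : C := bos_integral A (fun t => (ferm_exp s A * F t) top).

Lemma polyf_top F : polyform F -> polyf (fun t => (ferm_exp s A * F t) top : C).
Proof. by move=> pF; apply: (polyformM (polyform_cst _) pF). Qed.

Lemma expectD F G : polyform F -> polyform G ->
  expect (fun t => F t + G t) = expect F + expect G.
Proof.
move=> pF pG; rewrite -(bos_integralD c_gt0 A_coercive) //; try exact: polyf_top.
by congr bos_integral; apply/funext => t; rewrite mulrDr extDE.
Qed.

Lemma expectZ (a : C) F : polyform F -> expect (fun t => a *: F t) = a * expect F.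
Proof.
move=> pF; rewrite -(bos_integralZ c_gt0 A_coercive) //; last exact: polyf_top.
by congr bos_integral; apply/funext => t; rewrite -scalerAr extZE.
Qed.

Lemma expect_bos_ibp y F F' : dform y F F' ->
  \sum_z A y z * expect (fun t => cphibar z t *: F t) = expect F'.
Proof.
move=> dF; have dEF : wirtinger y (fun t => (ferm_exp s A * F t) top : C)
    (fun t => (ferm_exp s A * F' t) top : C).
  have := dformM (dform_cst y (ferm_exp s A)) dF => /(_ top).
  by under [X in wirtinger _ _ X -> _]eq_fun do rewrite mul0r add0r.
rewrite /expect (bos_ibp c_gt0 A_coercive dEF); apply: eq_bigr => z _.
by congr (_ * bos_integral _ _); apply/funext => t; rewrite -scalerAr extZE.
Qed.

Lemma expect_ferm_ibp y F : polyform F ->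
  \sum_z A y z * expect (fun t => psibar z * F t) = expect (fun t => dpsi y (F t)).
Proof.
move=> pF; have pz z : polyf (fun t => (ferm_exp s A * (psibar z * F t)) top : C).
  by apply: polyf_top; apply: polyformM => //; exact: polyform_cst.
have -> : expect (fun t => dpsi y (F t)) = bos_integral A (fun t =>
    \sum_z A y z * ((ferm_exp s A * (psibar z * F t)) top : C)).
  by congr bos_integral; apply/funext => t; rewrite ferm_ibp.
rewrite (bos_integral_sum c_gt0 A_coercive) => [|z]; last first.
  by apply: polyfM => //; exact: polyf_cst.
by apply: eq_bigr => z _; rewrite (bos_integralZ c_gt0 A_coercive).
Qed.

End Weight.
End Expectation.

(** * Recursions for products of the factors 1 + tau *)

Section Recursions.
Variables (R : realType) (L : finType) (s : R[i]).
Local Notation C := R[i].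
Local Notation point := (#|L|.*2.-tuple (measurableTypeR R)).
Local Notation ext := (extalg C #|L|.*2).
Local Notation psi := (grass_psi (L := L) s).
Local Notation psibar := (grass_psibar (L := L) s).
Local Notation dpsi := (grass_dpsi (L := L) s).
Implicit Types (f g : point -> C) (F G H : point -> ext) (x y z a b : L) (t : point)
  (r : seq L).

Definition ctau x t : ext := (cphi x t * cphibar x t)%:A + psi x * psibar x.

Definition tau_prod r t : ext := \prod_(x <- r) (1 + ctau x t).

Lemma dform_eq y F F1 F2 : dform y F F1 -> F1 =1 F2 -> dform y F F2.
Proof. by move=> dF /funext <-. Qed.

Lemma tau_prod_cons x r t : tau_prod (x :: r) t = (1 + ctau x t) * tau_prod r t.
Proof. by rewrite /tau_prod big_cons. Qed.

Lemma dform_tau x y :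
  dform y (fun t => 1 + ctau x t) (fun t => ((x == y)%:R * cphibar x t)%:A).
Proof.
have d1 := dformZ (wirtingerM (wirtinger_phi R y x) (wirtinger_phibar R y x)) (dform_cst y 1).
have d2 := dformD (dform_cst y 1) (dformD d1 (dform_cst y (psi x * psibar x))).
apply: dform_eq d2 _ => t.
by rewrite add0r addr0 scaler0 addr0 mulr0 addr0.
Qed.

(** Only the factor of index y depends on phi_y, and the derivative of tau_y in
    phi_y is phibar_y. *)
Lemma dform_tau_prod y r : uniq r ->
  dform y (tau_prod r) (fun t => if y \in r then cphibar y t *: tau_prod (rem y r) t else 0).
Proof.
elim: r => [_|x r IHr /= /andP[xr ur]].
  by rewrite (_ : tau_prod [::] = fun=> 1);
    [exact: dform_cst|apply/funext => t; rewrite /tau_prod big_nil].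
rewrite (_ : tau_prod (x :: r) = fun t => (1 + ctau x t) * tau_prod r t); last first.
  by apply/funext => t; rewrite tau_prod_cons.
apply: dform_eq (dformM (dform_tau x y) (IHr ur)) _ => t.
rewrite in_cons -scalerAl mul1r (eq_sym y x).
have [<-|xy] := eqVneq x y; first by rewrite (negPf xr) mul1r mulr0 addr0.
rewrite [false%:R * _]mul0r scale0r add0r; case: (y \in r); last by rewrite mulr0.
by rewrite tau_prod_cons scalerAr.
Qed.

Lemma polyform_tau_prod r : uniq r -> polyform (tau_prod r).
Proof.
case: r => [_|x r ur]; last by have [] := dform_poly (dform_tau_prod x ur).
rewrite (_ : tau_prod [::] = fun=> 1); first exact: polyform_cst.
by apply/funext => t; rewrite /tau_prod big_nil.
Qed.

Lemma tau_psibar x y t : GRing.comm (1 + ctau x t) (psibar y).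
Proof.
apply/commr_sym/commrD; first exact: commr1.
apply: commrD; first by apply: commZr; exact: commr1.
by apply/commr_sym; exact: pair_psibar.
Qed.

Section Inverse.
Variables (A Cinv : L -> L -> C) (c : R).
Hypotheses (s_neq0 : s != 0) (c_gt0 : 0 < c) (A_coercive : coercive c (bos_action A)).
Hypothesis CinvA : forall x z, \sum_y Cinv x y * A y z = (x == z)%:R.
Local Notation expect := (expect s A).

Lemma dpsi_tauM y x t (h : ext) :
  dpsi y ((1 + ctau x t) * h) = (x == y)%:R *: (psibar x * h) + (1 + ctau x t) * dpsi y h.
Proof.
rewrite /ctau !mulrDl !mul1r -!scalerAl !mul1r !dpsiD dpsiZ (dpsi_pairM s_neq0).
by rewrite [in RHS]addrCA; congr (_ + _); rewrite addrCA.
Qed.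

Lemma dpsi_tau_prod y r t : uniq r ->
  dpsi y (tau_prod r t) = if y \in r then psibar y * tau_prod (rem y r) t else 0.
Proof.
elim: r => [_|x r IHr /= /andP[xr ur]]; first by rewrite /tau_prod big_nil dpsi_1.
rewrite tau_prod_cons dpsi_tauM (IHr ur) in_cons (eq_sym y x).
have [<-|xy] := eqVneq x y; first by rewrite (negPf xr) scale1r mulr0 addr0.
rewrite scale0r add0r; case: (y \in r); last by rewrite mulr0.
by rewrite tau_prod_cons !mulrA tau_psibar.
Qed.

(** Multiplication by the inverse isolates the term of index a in the integrations
    by parts. *)
Lemma sum_Cinv (X : L -> C) a : \sum_y Cinv a y * (\sum_z A y z * X z) = X a.
Proof.
under eq_bigr do rewrite mulr_sumr.
rewrite exchange_big /= (eq_bigr (fun z => (a == z)%:R * X z)) => [|z _].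
  rewrite (bigD1 a) //= eqxx mul1r big1 ?addr0 // => z.
  by rewrite eq_sym => /negPf ->; rewrite mul0r.
by rewrite -CinvA mulr_suml; apply: eq_bigr => y _; rewrite mulrA.
Qed.

Lemma expect_phibar a F (F' : L -> point -> ext) : (forall y, dform y F (F' y)) ->
  expect (fun t => cphibar a t *: F t) = \sum_y Cinv a y * expect (F' y).
Proof.
move=> dF; rewrite -(sum_Cinv (fun z => expect (fun t => cphibar z t *: F t)) a).
by apply: eq_bigr => y _; rewrite (expect_bos_ibp s c_gt0 A_coercive (dF y)).
Qed.

Lemma expect_psibar a F : polyform F ->
  expect (fun t => psibar a * F t) = \sum_y Cinv a y * expect (fun t => dpsi y (F t)).
Proof.
move=> pF; rewrite -(sum_Cinv (fun z => expect (fun t => psibar z * F t)) a).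
by apply: eq_bigr => y _; rewrite (expect_ferm_ibp s_neq0 c_gt0 A_coercive y pF).
Qed.

Lemma expect0 : expect (fun=> 0) = 0.
Proof.
have := expectZ s c_gt0 A_coercive 0 (polyform_cst (0 : ext)).
by rewrite mul0r scale0r.
Qed.

(** A contribution to the gradient of a product over r is indexed by the factor
    that is differentiated. *)
Lemma sum_mem_seq (X Y : L -> C) r : uniq r ->
  \sum_y X y * (if y \in r then Y y else 0) = \sum_(y <- r) X y * Y y.
Proof.
move=> ur; rewrite [RHS]big_uniq //= [RHS]big_mkcond; apply: eq_bigr => y _.
by case: (y \in r); rewrite ?mulr0.
Qed.

Lemma sum_delta (X : L -> C) (Y : C) b : \sum_y X y * ((b == y)%:R * Y) = X b * Y.
Proof.
rewrite (bigD1 b) //= eqxx mul1r big1 ?addr0 // => y.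
by rewrite eq_sym => /negPf ->; rewrite mul0r mulr0.
Qed.

(** The term Cinv z x comes from the derivative of phi_x, and the others from the
    factors of the product. *)
Lemma expect_pair_phi x z r : uniq r ->
  expect (fun t => (cphibar z t * cphi x t) *: tau_prod r t) =
  Cinv z x * expect (tau_prod r) +
  \sum_(y <- r) Cinv z y * expect (fun t => (cphibar y t * cphi x t) *: tau_prod (rem y r) t).
Proof.
move=> ur; have pG := polyform_tau_prod ur.
pose F' y t := (x == y)%:R *: tau_prod r t +
  (if y \in r then (cphibar y t * cphi x t) *: tau_prod (rem y r) t else 0).
have dF y : dform y (fun t => cphi x t *: tau_prod r t) (F' y).
  apply: dform_eq (dformZ (wirtinger_phi R y x) (dform_tau_prod y ur)) _ => t.
  rewrite /F'; congr (_ + _); case: (y \in r); last by rewrite scaler0.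
  by rewrite scalerA mulrC.
transitivity (expect (fun t => cphibar z t *: (cphi x t *: tau_prod r t))).
  by congr expect; apply/funext => t; rewrite scalerA.
rewrite (expect_phibar z dF) -(sum_delta (Cinv z) (expect (tau_prod r))).
rewrite -(sum_mem_seq (Cinv z) _ ur) -big_split; apply: eq_bigr => y _ /=.
rewrite -mulrDr; congr (_ * _).
have pd : polyform (fun t => if y \in r then
    (cphibar y t * cphi x t) *: tau_prod (rem y r) t else 0).
  case: (y \in r); last exact: polyform_cst.
  apply: polyformZ; last by apply: polyform_tau_prod; rewrite rem_uniq.
  by apply: polyfM; [exact: polyf_phibar|exact: polyf_phi].
rewrite /F' (expectD s c_gt0 A_coercive) //; last first.
  by apply: polyformZ => //; exact: polyf_cst.
rewrite (expectZ s c_gt0 A_coercive) //; congr (_ + _).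
case: (y \in r); first by [].
by rewrite -[RHS]expect0.
Qed.

(** The counterpart of expect_pair_phi: psi_x and psibar_z are interchanged before
    the integration by parts, which reverses the sign of the term Cinv z x. The
    other terms get a second sign when psi_x is moved past the derivation. *)
Lemma expect_pair_psi x z r : uniq r ->
  expect (fun t => psi x * psibar z * tau_prod r t) =
  - (Cinv z x * expect (tau_prod r)) +
  \sum_(y <- r) Cinv z y * expect (fun t => psi x * psibar y * tau_prod (rem y r) t).
Proof.
move=> ur; have pG := polyform_tau_prod ur.
have pF : polyform (fun t => psi x * tau_prod r t).
  by apply: polyformM => //; exact: polyform_cst.
have pH : polyform (fun t => psibar z * (psi x * tau_prod r t)).
  by apply: polyformM => //; exact: polyform_cst.
transitivity (expect (fun t => -1 *: (psibar z * (psi x * tau_prod r t)))).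
  congr expect; apply/funext => t.
  by rewrite psi_psibar mulNr -mulrA scaleN1r.
rewrite (expectZ s c_gt0 A_coercive) // (expect_psibar z pF).
rewrite -(sum_delta (Cinv z) (expect (tau_prod r))) -(sum_mem_seq (Cinv z) _ ur).
rewrite mulN1r -!sumrN -big_split; apply: eq_bigr => y _ /=.
rewrite -!mulrN -mulrDr; congr (_ * _).
have -> : (fun t => dpsi y (psi x * tau_prod r t)) = (fun t => (x == y)%:R *: tau_prod r t +
    (-1) *: (if y \in r then psi x * psibar y * tau_prod (rem y r) t else 0)).
  apply/funext => t; rewrite dpsi_psiM // (dpsi_tau_prod _ _ ur) scaleN1r.
  by case: (y \in r); rewrite ?mulr0 ?mulrA.
have pd : polyform (fun t : point => if y \in r then
    psi x * psibar y * tau_prod (rem y r) t else 0).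
  case: (y \in r); last exact: polyform_cst.
  apply: polyformM; first exact: polyform_cst.
  by apply: polyform_tau_prod; rewrite rem_uniq.
rewrite (expectD s c_gt0 A_coercive); last 2 first.
- by apply: polyformZ => //; exact: polyf_cst.
- by apply: polyformZ => //; exact: polyf_cst.
rewrite !(expectZ s c_gt0 A_coercive) // opprD mulN1r opprK mulrN; congr (_ + _).
case: (y \in r); first by [].
by rewrite -[RHS]expect0.
Qed.

(** Supersymmetry: the terms Cinv z x of the two recursions cancel, and the
    remaining ones are of the same form for a shorter product. *)
Lemma expect_super_pair x z r : uniq r ->
  expect (fun t => (cphibar z t * cphi x t) *: tau_prod r t) +
  expect (fun t => psi x * psibar z * tau_prod r t) = 0.
Proof.
move: {2}(size r) (erefl (size r)) => m; elim: m r z => [|m IHm] r z sr ur.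
  have sum0 (F : L -> C) : \sum_(y <- r) F y = 0 by rewrite (size0nil sr) big_nil.
  have add0 (u v : C) (F : L -> C) : u = v + \sum_(y <- r) F y -> u = v.
    by rewrite sum0 addr0.
  rewrite (add0 _ _ _ (expect_pair_phi x z ur)).
  rewrite (add0 _ _ _ (expect_pair_psi x z ur)).
  exact: subrr.
rewrite (expect_pair_phi _ _ ur) (expect_pair_psi _ _ ur).
rewrite addrACA subrr add0r -big_split /=.
rewrite big_seq big1 // => y yr; rewrite -mulrDr IHm ?rem_uniq ?mulr0 //.
by rewrite size_rem // sr.
Qed.

Lemma expect_tau_prod r : uniq r -> expect (tau_prod r) = expect (fun=> 1).
Proof.
elim: r => [_|x r IHr /= /andP[_ ur]].
  by congr expect; apply/funext => t; rewrite /tau_prod big_nil.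
have pG := polyform_tau_prod ur; rewrite -(IHr ur).
pose B t := (cphibar x t * cphi x t) *: tau_prod r t.
pose D t := psi x * psibar x * tau_prod r t.
have pB : polyform B.
  by apply: polyformZ => //; apply: polyfM; [exact: polyf_phibar|exact: polyf_phi].
have pD : polyform D by apply: polyformM => //; exact: polyform_cst.
transitivity (expect (fun t => tau_prod r t + (B t + D t))).
  congr expect; apply/funext => t; rewrite tau_prod_cons /ctau /B /D.
  by rewrite !mulrDl -scalerAl !mul1r (mulrC (cphi x t)).
rewrite (expectD s c_gt0 A_coercive pG (polyformD pB pD)).
by rewrite (expectD s c_gt0 A_coercive pB pD) (expect_super_pair x x ur) addr0.
Qed.

End Inverse.
End Recursions.

(** * Derivatives along a path of actions *)

Section DifferentiationUnderIntegral.
Variables (R : realType) (n : nat).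
Local Open Scope classical_set_scope.
Local Notation C := R[i].
Local Notation re := (@complex.Re R).
Local Notation im := (@complex.Im R).
Local Notation point := (n.-tuple (measurableTypeR R)).
Local Notation leb := (lebesgue_tuple R n).

Lemma is_derive_integral c K (h h' : R -> point -> R) (x : R) : 0 < c ->
  (forall y, leb.-integrable setT (EFin \o h y)) ->
  (forall y t, is_derive y (1 : R) (h ^~ t) (h' y t)) ->
  (forall y t, `|h' y t| <= K * ngauss c t) ->
  is_derive x (1 : R) (fun y => \int[leb]_t h y t) (\int[leb]_t h' x t).
Proof.
move=> c0 hi hh' h'K.
have xI : `]x - 1, x + 1[ x by rewrite /= in_itv /= ltrBlDr !ltrDl !ltr01.
have dh y t : derivable (h ^~ t) y 1 by exact: ex_derive.
have d1E y t : partial1of2 h y t = h' y t by rewrite /partial1of2 derive1E; exact: derive_val.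
have Ki : leb.-integrable setT (EFin \o (fun t => `|K| * ngauss c t)).
  rewrite /comp; under eq_fun do rewrite EFinM.
  by apply: integrableZl => //; exact: integrable_ngauss.
have K0 (t : point) : 0 <= `|K| * ngauss c t by rewrite mulr_ge0 // expR_ge0.
have KK y t : `|partial1of2 h y t| <= `|K| * ngauss c t.
  by rewrite d1E (le_trans (h'K y t)) // ler_wpM2r ?expR_ge0 // ler_norm.
apply: DeriveDef.
  exact: (derivable_under_integral measurableT xI (fun y _ => hi y)
    (fun y t _ _ => dh y t) K0 Ki (fun y t _ _ => KK y t)).
rewrite -derive1E.
rewrite (differentiation_under_integral measurableT xI (fun y _ => hi y)
  (fun y t _ _ => dh y t) K0 Ki (fun y t _ _ => KK y t)).
by apply: eq_Rintegral => t _; rewrite d1E.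
Qed.

Lemma cderive_integral c K (h h' : R -> point -> C) (x : R) : 0 < c ->
  (forall y, gauss_bounded c (h y)) ->
  (forall y t, cderive (h ^~ t) y (h' y t)) ->
  (forall y t, norm1 (h' y t) <= K * ngauss c t) ->
  cderive (fun y => cintegral (h y)) x (cintegral (h' x)).
Proof.
move=> c0 hb hh' h'K; split.
  apply: (@is_derive_integral c K (fun y t => re (h y t)) (fun y t => re (h' y t))) => //.
  - by move=> y; have [] := gauss_bounded_integrable c0 (hb y).
  - by move=> y t; have [] := hh' y t.
  - by move=> y t; exact: le_trans (normRe_le _) (h'K y t).
apply: (@is_derive_integral c K (fun y t => im (h y t)) (fun y t => im (h' y t))) => //.
- by move=> y; have [] := gauss_bounded_integrable c0 (hb y).
- by move=> y t; have [] := hh' y t.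
- by move=> y t; exact: le_trans (normIm_le _) (h'K y t).
Qed.

Lemma cderive_0_cst (h : R -> C) : (forall x, cderive h x 0) -> forall x y, h x = h y.
Proof.
move=> h0 x y; rewrite (complex_eta (h x)) (complex_eta (h y)); congr (_ +i* _).
  exact: (@is_derive_0_is_cst R (re \o h) x y (fun z => proj1 (h0 z))).
exact: (@is_derive_0_is_cst R (im \o h) x y (fun z => proj2 (h0 z))).
Qed.

End DifferentiationUnderIntegral.

Section FermionicDeformation.
Variables (R : realType) (L : finType) (s : R[i]).
Local Notation C := R[i].
Local Notation ext := (extalg C #|L|.*2).
Implicit Types (A B : L -> L -> C) (F G : R -> ext).

Definition cderive_ext F x (F' : ext) : Prop :=
  forall S, cderive (fun y => F y S : C) x (F' S).

Lemma cderive_ext_cst (e : ext) x : cderive_ext (fun=> e) x 0.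
Proof. by move=> S; rewrite ffunE; exact: cderive_cst. Qed.

Lemma cderive_extM F G x (F' G' : ext) : cderive_ext F x F' -> cderive_ext G x G' ->
  cderive_ext (fun y => F y * G y) x (F' * G x + F x * G').
Proof.
move=> dF dG S; under eq_fun do rewrite ext_mulE.
rewrite extDE !ext_mulE -big_split; apply: cderive_sum => T _ /=.
by rewrite -mulrDr; apply: cderiveZ; exact: cderiveM.
Qed.

Lemma cderive_extX F x (F' : ext) k : cderive_ext F x F' -> GRing.comm F' (F x) ->
  cderive_ext (fun y => F y ^+ k) x (k%:R *: (F' * F x ^+ k.-1)).
Proof.
move=> dF cF; elim: k => [|k IHk].
  rewrite scale0r; exact: cderive_ext_cst.
have := cderive_extM dF IHk; under eq_fun do rewrite -exprS.
congr cderive_ext; rewrite /= -scalerAr mulrA -cF -mulrA.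
case: k {IHk} => [|k] /=; first by rewrite scale0r addr0 scale1r.
by rewrite -exprS -{1}[_ * _]scale1r -scalerDl nat1r.
Qed.

Lemma cderive_ext_sum (I : Type) (r : seq I) (F : I -> R -> ext) (F' : I -> ext) x :
  (forall i, cderive_ext (F i) x (F' i)) ->
  cderive_ext (fun y => \sum_(i <- r) F i y) x (\sum_(i <- r) F' i).
Proof.
move=> dF S; under eq_fun do rewrite ext_sumE.
by rewrite ext_sumE; apply: cderive_sum => i _; exact: dF.
Qed.

Lemma cderive_extZ (a : C) F x (F' : ext) : cderive_ext F x F' ->
  cderive_ext (fun y => a *: F y) x (a *: F').
Proof.
by move=> dF S; under eq_fun do rewrite extZE; rewrite extZE; exact: cderiveZ.
Qed.

Lemma ferm_actionD A B (a : C) : ferm_action s (fun x z => A x z + a * B x z) =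
  ferm_action s A + a *: ferm_action s B.
Proof.
rewrite ferm_action.unlock scaler_sumr -big_split; apply: eq_bigr => x _ /=.
rewrite scaler_sumr -big_split; apply: eq_bigr => z _ /=.
by rewrite scalerDl scalerA.
Qed.

(** The derivative of the action is even, so it commutes with the action and the
    exponential is differentiated as in the commutative case; the truncation is
    harmless because the last term would have degree 2 #|L| + 2. *)
Lemma cderive_ferm_exp A B (g : R -> R) x (dg : R) : is_derive x (1 : R) g dg ->
  cderive_ext (fun y => ferm_exp s (fun z w => A z w + (g y)%:C * B z w)) x
    (- dg%:C *: (ferm_exp s (fun z w => A z w + (g x)%:C * B z w) * ferm_action s B)).
Proof.
move=> dgx.
pose N := ferm_action s B; pose P y := - (ferm_action s A + (g y)%:C *: N).
have PE y : - ferm_action s (fun z w => A z w + (g y)%:C * B z w) = P y.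
  by rewrite ferm_actionD.
have dP : cderive_ext P x (- dg%:C *: N).
  move=> S; rewrite /P; under eq_fun do rewrite extNE extDE extZE.
  rewrite extZE mulNr; apply: cderiveN.
  have := cderiveD (cderive_cst (ferm_action s A S : C) x)
     (cderiveM (cderive_real dgx) (cderive_cst (N S : C) x)).
  by rewrite add0r mulr0 addr0.
have cNP : GRing.comm N (P x).
  by rewrite -PE; apply: commrN; exact: action_action.
have cP : GRing.comm (- dg%:C *: N) (P x).
  by apply/commr_sym/commZr/commr_sym.
have d : cderive_ext (fun y => \sum_(k < #|L|.+1) (k`!%:R : C)^-1 *: P y ^+ k) x
   (\sum_(k < #|L|.+1) (k`!%:R : C)^-1 *: (k%:R *: ((- dg%:C *: N) * P x ^+ k.-1))).
  by apply: cderive_ext_sum => k; apply: cderive_extZ; exact: cderive_extX.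
have -> : (fun y => ferm_exp s (fun z w => A z w + (g y)%:C * B z w)) =
    (fun y => \sum_(k < #|L|.+1) (k`!%:R : C)^-1 *: P y ^+ k).
  by apply/funext => y; rewrite /ferm_exp PE.
congr cderive_ext: d.
have topN : N * P x ^+ #|L| = 0.
  apply: (@degree_ge_eq0 _ _ #|L|.*2.+2) => //; rewrite -PE.
  rewrite -scaleN1r exprZn -scalerAr; apply: degree_geZ.
  by apply/degree_ge_action/degree_ge_actionX.
have cX k : P x ^+ k * N = N * P x ^+ k by rewrite (commrX k cNP).
rewrite big_ord_recl scale0r scaler0 add0r /ferm_exp PE trunc_exp_recr.
rewrite mulrDl -scalerAl cX topN scaler0 addr0 mulr_suml scaler_sumr.
apply: eq_bigr => k _; rewrite lift0 scalerA fact_invS /= -!scalerAl cX.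
by rewrite !scalerA mulrC.
Qed.

End FermionicDeformation.

(** * Coordinates and coercive actions *)

Section Coordinates.
Variables (R : realType) (L : finType).
Local Notation C := R[i].
Local Notation point := (#|L|.*2.-tuple (measurableTypeR R)).
Implicit Types (x y z : L) (t : point) (A B : L -> L -> C) (c : R).

Definition uv_pair (p : L * bool) : 'I_#|L|.*2 := uv_index p.1 p.2.

Lemma uv_pair_bij : bijective uv_pair.
Proof.
apply: inj_card_bij => [[x b] [y d] /eqP|]; rewrite /uv_pair /=.
  by rewrite uv_index_inj => /andP[/eqP -> /eqP ->].
by rewrite card_prod card_bool card_ord muln2.
Qed.

Lemma sum_uv (F : 'I_#|L|.*2 -> R) :
  \sum_i F i = \sum_x (F (uv_index x false) + F (uv_index x true)).
Proof.
have [g gK Kg] := uv_pair_bij.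
rewrite (reindex uv_pair) /=; last by exists g => i _; [exact: gK|exact: Kg].
rewrite -(pair_big predT predT (fun x b => F (uv_index x b))) /=.
by apply: eq_bigr => x _; rewrite big_bool addrC.
Qed.

Lemma exists_point (v : L -> C) : exists t, forall x, cphi x t = v x.
Proof.
have [g gK Kg] := uv_pair_bij.
exists [tuple (let p := g i in if p.2 then complex.Im (v p.1) else complex.Re (v p.1))
  | i < #|L|.*2] => x.
have gE b : g (uv_index x b) = (x, b) by rewrite -(gK (x, b)).
by rewrite /cphi !tnth_mktuple !gE /=; case: (v x).
Qed.

Lemma bos_action_delta t : bos_action (fun x z => (x == z)%:R) t = (sqnorm t)%:C.
Proof.
rewrite /bos_action /sqnorm (sum_uv (fun i => tnth t i ^+ 2)) rmorph_sum.
apply: eq_bigr => x _; rewrite (bigD1 x) //= eqxx mul1r big1 ?addr0.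
  apply/eqP; rewrite eq_complex /cphi /cphibar /=.
  by apply/andP; split; apply/eqP; ring.
by move=> z; rewrite eq_sym => /negPf ->; rewrite mul0r.
Qed.

Lemma bos_actionD A B (k : C) t :
  bos_action (fun x z => A x z + k * B x z) t = bos_action A t + k * bos_action B t.
Proof.
rewrite /bos_action mulr_sumr -big_split; apply: eq_bigr => x _ /=.
rewrite mulr_sumr -big_split; apply: eq_bigr => z _ /=.
by ring.
Qed.

Lemma sqnorm_eq0 t : sqnorm t <= 0 -> forall x, cphi x t = 0.
Proof.
move=> t0 x; have h i : tnth t i = 0 :> R.
  have : \sum_(j < #|L|.*2) (tnth t j : R) ^+ 2 == 0 by rewrite eq_le t0 sqnorm_ge0.
  rewrite psumr_eq0; last by move=> j _; exact: sqr_ge0.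
  by move=> /allP /(_ i (mem_index_enum i)); rewrite /= sqrf_eq0 => /eqP.
by rewrite /cphi !h.
Qed.

(** A vector in the left kernel of A would be a zero of phi A phibar. *)
Lemma coercive_invertible A c : 0 < c -> coercive c (bos_action A) ->
  exists Cinv : L -> L -> C, forall x z, \sum_y Cinv x y * A y z = (x == z)%:R.
Proof.
move=> c0 cA; pose M : 'M[C]_#|L| := \matrix_(i, j) A (enum_val i) (enum_val j).
have sumE (F : L -> C) : \sum_y F y = \sum_(i < #|L|) F (enum_val i).
  by rewrite (reindex (@enum_val L predT)) //=; exact/onW_bij/enum_val_bij.
have Mu : M \in unitmx.
  rewrite -row_free_unit -kermx_eq0; apply/eqP/row_matrixP => i; rewrite row0.
  set v := row i _; have vM : v *m M = 0 by rewrite -row_mul mulmx_ker row0.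
  have [t tv] := exists_point (fun x => v 0 (enum_rank x)).
  have q0 : bos_action A t = 0.
    rewrite /bos_action exchange_big /= big1 // => z _.
    under eq_bigr do rewrite mulrA; rewrite -mulr_suml.
    have -> : \sum_x A x z * cphi x t = (v *m M) 0 (enum_rank z).
      rewrite mxE sumE; apply: eq_bigr => j _.
      by rewrite tv enum_valK !mxE enum_rankK mulrC.
    by rewrite vM mxE mul0r.
  have t0 : sqnorm t <= 0.
    by have := cA t; rewrite q0 /= pmulr_rle0.
  apply/rowP => j; rewrite [RHS]mxE -(enum_valK j) -tv.
  exact: sqnorm_eq0.
exists (fun x z => invmx M (enum_rank x) (enum_rank z)) => x z.
have : (invmx M *m M) (enum_rank x) (enum_rank z) = (x == z)%:R.
  by rewrite mulVmx // mxE (inj_eq enum_rank_inj).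
rewrite mxE sumE => <-; apply: eq_bigr => j _.
by rewrite enum_valK mxE enum_rankK.
Qed.

End Coordinates.

(** * The identity matrix *)

Section IdentityCase.
Variables (R : realType) (L : finType) (s : R[i]).
Hypothesis hs : s ^+ 2 = 2 * pi%:C * 'i.
Local Notation C := R[i].
Local Notation ext := (extalg C #|L|.*2).
Local Notation top := [set: 'I_#|L|.*2]%SET.
Local Notation psi := (grass_psi (L := L) s).
Local Notation psibar := (grass_psibar (L := L) s).
Local Notation dpsi := (grass_dpsi (L := L) s).
Local Notation delta := (fun x z : L => (x == z)%:R : C).

Lemma piC_neq0 : (pi : R)%:C != 0.
Proof. by rewrite eq_complex /= eqxx andbT gt_eqF // pi_gt0. Qed.

Lemma root_neq0 : s != 0.
Proof.
apply/eqP => s0; move: hs; rewrite s0 expr0n /= => /esym/eqP.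
by rewrite !mulf_eq0 (negPf piC_neq0) pnatr_eq0 /= (negPf (neq0Ci _)).
Qed.

Lemma psibar_psi_uv x : psibar x * psi x =
  (pi%:C)^-1 *: (ext_gen C (uv_index x false) * ext_gen C (uv_index x true)).
Proof.
rewrite grass_psi.unlock grass_psibar.unlock.
set u := ext_gen _ _; set v := ext_gen _ _.
rewrite -scalerAl -scalerAr scalerA mulrDl !mulrDr -!scalerAl -!scalerAr.
have -> : v * u = - (u * v) by exact: ext_gen_anticomm.
rewrite !ext_gen_sq !scaler0 add0r addr0 scalerN scaleNr opprK -scalerDl scalerA.
congr (_ *: _); rewrite -invfM -expr2 hs.
have := piC_neq0; move: (pi%:C : C) => p p0.
have i0 : 'i != 0 :> C := neq0Ci _.
by field; rewrite p0 i0.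
Qed.

Definition psi_prod (r : seq L) : ext := \prod_(x <- r) (psibar x * psi x).

Lemma dpsi_psi_prod y r : y \notin r -> dpsi y (psi_prod r) = 0.
Proof.
elim: r => [_|x r IHr]; first by rewrite /psi_prod big_nil dpsi_1.
rewrite in_cons negb_or => /andP[yx yr]; rewrite /psi_prod big_cons -/(psi_prod r).
rewrite -mulrA dpsi_psibarM (dpsi_psiM root_neq0) (IHr yr).
by rewrite eq_sym (negPf yx) scale0r mulr0 subr0 mulr0 oppr0.
Qed.

(** Integration by parts inserts the pairs psibar_x psi_x one at a time, since the
    derivative of psi_x g in psi_x is g when g does not involve psi_x. *)
Lemma ferm_exp_psi_prod r : uniq r ->
  (ferm_exp s delta * psi_prod r) top = (ferm_exp s delta * 1) top.
Proof.
elim: r => [_|x r IHr /= /andP[xr ur]]; first by rewrite /psi_prod big_nil.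
rewrite -(IHr ur) /psi_prod big_cons -/(psi_prod r) -mulrA.
have := ferm_ibp root_neq0 delta x (psi x * psi_prod r).
rewrite (dpsi_psiM root_neq0) (dpsi_psi_prod xr) eqxx scale1r mulr0 subr0 => <-.
rewrite (bigD1 x) //= eqxx mul1r big1 ?addr0 // => z.
by rewrite eq_sym => /negPf ->; rewrite mul0r.
Qed.

Lemma degree_ge_psi_prod r : degree_ge (size r).*2 (psi_prod r).
Proof.
elim: r => [S //|x r IHr]; rewrite /psi_prod big_cons -/(psi_prod r) -mulrA /= doubleS.
exact/degree_ge_psibar/degree_ge_psi.
Qed.

(** The product over all x has top degree already, so only the constant term of
    the exponential contributes. *)
Lemma ferm_exp_psi_prod_enum A :
  ferm_exp s A * psi_prod (enum L) = psi_prod (enum L).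
Proof.
have NQ : ferm_action s A * psi_prod (enum L) = 0.
  apply: (@degree_ge_eq0 _ _ #|L|.*2.+2) => //.
  by apply: degree_ge_action; have := @degree_ge_psi_prod (enum L); rewrite -cardE.
rewrite /ferm_exp /trunc_exp mulr_suml big_ord_recl fact0 invr1 scale1r mul1r big1 ?addr0 //.
by move=> k _; rewrite -scalerAl lift0 exprSr -mulrA mulNr NQ oppr0 mulr0 scaler0.
Qed.

Lemma flatten_iota m : flatten [seq [:: j.*2; j.*2.+1] | j <- iota 0 m] = iota 0 m.*2.
Proof.
elim: m => // m IHm; rewrite -addn1 iotaD map_cat flatten_cat IHm /= add0n.
by rewrite doubleD -[in RHS]muln2 -[X in iota _ (_ + X)]/2%N iotaD /= add0n muln2.
Qed.

Lemma map_index_iota (T : eqType) (r : seq T) : uniq r ->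
  map (fun x => index x r) r = iota 0 (size r).
Proof.
case: r => // x0 r ur; apply: (@eq_from_nth _ 0%N); first by rewrite size_map size_iota.
move=> i; rewrite size_map => ir.
by rewrite (nth_map x0) // nth_iota // index_uniq.
Qed.

(** The order u_0, v_0, u_1, v_1, and so on, of the coordinates is the one in which
    the pairs are enumerated, so no sign arises. *)
Lemma prod_uv_gen : \prod_(x <- enum L) (ext_gen C (uv_index x false) *
  ext_gen C (uv_index x true)) = \prod_(i < #|L|.*2) ext_gen C i.
Proof.
pose uvs (x : L) := [:: uv_index x false; uv_index x true].
have -> : \prod_(i < #|L|.*2) ext_gen C i = \prod_(i <- flatten (map uvs (enum L))) ext_gen C i.
  congr bigop; apply: (inj_map val_inj).
  rewrite map_flatten -map_comp /=.
  have -> : map val (index_enum 'I_#|L|.*2) = iota 0 #|L|.*2.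
    by rewrite /index_enum unlock -enumT val_enum_ord.
  rewrite -flatten_iota.
  have -> : iota 0 #|L| = map (fun x : L => val (enum_rank x)) (enum L).
    transitivity (iota 0 (size (enum L))); first by rewrite -cardE.
    rewrite -(map_index_iota (enum_uniq L)); apply: eq_map => x.
    by rewrite -{1}(nth_enum_rank x x) index_uniq ?enum_uniq // -cardE.
  rewrite -map_comp; congr flatten; apply: eq_map => x /=.
  by rewrite addn0 addn1.
rewrite big_flatten big_map; apply: eq_bigr => x _.
by rewrite /uvs !big_cons big_nil /= mulr1.
Qed.

Lemma ferm_exp_delta_top : (ferm_exp s delta * 1) top = (pi%:C)^-1 ^+ #|L| :> C.
Proof.
rewrite -(ferm_exp_psi_prod (enum_uniq L)) ferm_exp_psi_prod_enum /psi_prod.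
under eq_bigr do rewrite psibar_psi_uv.
have scale_prod (k : C) (F : L -> ext) (r : seq L) :
    \prod_(x <- r) (k *: F x) = k ^+ size r *: \prod_(x <- r) F x.
  elim: r => [|x r IHr]; first by rewrite !big_nil scale1r.
  by rewrite !big_cons IHr -scalerAl -scalerAr scalerA -exprS.
by rewrite scale_prod prod_uv_gen prod_ext_gen extZE ffunE eqxx mulr1 cardE.
Qed.

Lemma bos_integral_delta : bos_integral delta (fun=> 1) = (pi%:C) ^+ #|L| :> C.
Proof.
rewrite /bos_integral /cintegral.
have e (t : #|L|.*2.-tuple (measurableTypeR R)) :
    1 * expC (- bos_action delta t) = (ngauss 1 t)%:C :> C.
  rewrite mul1r bos_action_delta /expC /ngauss mul1r /= oppr0 cos0 sin0.
  by rewrite (_ : 1 +i* 0 = 1) // mulr1.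
under eq_Rintegral do rewrite e /=.
under [X in _ +i* X]eq_Rintegral do rewrite e /=.
rewrite integral_ngauss1 Rintegral_cst // mul0r -muln2 mulnC exprM sqr_sqrtr ?pi_ge0 //.
by rewrite -rmorphXn.
Qed.

End IdentityCase.

(** * Normalization *)

Section Normalization.
Variables (R : realType) (L : finType) (s : R[i]).
Hypothesis hs : s ^+ 2 = 2 * pi%:C * 'i.
Local Notation C := R[i].
Local Notation point := (#|L|.*2.-tuple (measurableTypeR R)).
Local Notation ext := (extalg C #|L|.*2).
Local Notation top := [set: 'I_#|L|.*2]%SET.
Local Notation psi := (grass_psi (L := L) s).
Local Notation psibar := (grass_psibar (L := L) s).
Local Notation delta := (fun x z : L => (x == z)%:R : C).
Implicit Types (A B : L -> L -> C) (c : R).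

Lemma expect_cst A c (e : ext) : 0 < c -> coercive c (bos_action A) ->
  expect s A (fun=> e) = (ferm_exp s A * e) top * bos_integral A (fun=> 1).
Proof.
move=> c0 cA; rewrite -(bos_integralZ c0 cA); last exact: polyf_cst.
by congr bos_integral; apply/funext => t; rewrite mulr1.
Qed.

(** An action is a combination of the pairs of expect_super_pair, here with the
    empty product. *)
Lemma expect_action0 A B c : 0 < c -> coercive c (bos_action A) ->
  (ferm_exp s A * ferm_action s B) top * bos_integral A (fun=> 1) +
  (ferm_exp s A * 1) top * bos_integral A (bos_action B) = 0 :> C.
Proof.
move=> c0 cA; have [Cinv CA] := coercive_invertible c0 cA.
have s0 := root_neq0 hs.
have pp x z : polyf (fun t : point => cphi x t * cphibar z t).
  by apply: polyfM; [exact: polyf_phi|exact: polyf_phibar].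
have H x z : (ferm_exp s A * (psi x * psibar z)) top * bos_integral A (fun=> 1) +
    (ferm_exp s A * 1) top * bos_integral A (fun t => cphi x t * cphibar z t) = 0 :> C.
  rewrite -(expect_cst _ c0 cA) -(bos_integralZ c0 cA) // addrC.
  have <- : expect s A (fun t => (cphibar z t * cphi x t) *: tau_prod s [::] t) =
      bos_integral A (fun t => ((ferm_exp s A * 1) top : C) * (cphi x t * cphibar z t)).
    rewrite /expect; congr bos_integral; apply/funext => t.
    by rewrite /tau_prod big_nil -scalerAr extZE mulrC (mulrC (cphi x t)).
  have <- : expect s A (fun t => psi x * psibar z * tau_prod s [::] t) =
      expect s A (fun=> psi x * psibar z).
    rewrite /expect; congr bos_integral; apply/funext => t.
    by rewrite /tau_prod big_nil mulr1.
  exact: (expect_super_pair s0 c0 cA CA x z (r := [::]) isT).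
have -> : bos_integral A (bos_action B) =
    \sum_x \sum_z B x z * bos_integral A (fun t => cphi x t * cphibar z t).
  rewrite (bos_integral_sum c0 cA) => [|x]; last first.
    by apply: polyf_sum => z _; apply: polyfM => //; exact: polyf_cst.
  apply: eq_bigr => x _; rewrite (bos_integral_sum c0 cA) => [|z]; last first.
    by apply: polyfM => //; exact: polyf_cst.
  by apply: eq_bigr => z _; rewrite (bos_integralZ c0 cA).
rewrite ferm_action.unlock !mulr_sumr ext_sumE mulr_suml -big_split big1 // => x _ /=.
rewrite !mulr_sumr ext_sumE mulr_suml -big_split big1 // => z _ /=.
rewrite -scalerAr extZE -mulrA [X in _ + X]mulrCA -mulrDr.
by rewrite (H x z) mulr0.
Qed.

Variables (A : L -> L -> C) (c : R).
Hypotheses (c_gt0 : 0 < c) (c_le1 : c <= 1) (A_coercive : coercive c (bos_action A)).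

(** The action along a path from A, at x = 0, to the identity, at x = pi / 2;
    the squared sine keeps the whole line inside the segment between the two. *)
Definition path_action (x : R) : L -> L -> C :=
  fun y z => A y z + (sin x ^+ 2)%:C * (delta y z - A y z).

Local Notation B := (fun y z => delta y z - A y z).

Lemma bos_action_B t : bos_action B t = (sqnorm t)%:C - bos_action A t.
Proof.
have -> : B = fun y z => delta y z + (-1) * A y z.
  by apply/funext => y; apply/funext => z; rewrite mulN1r.
by rewrite (bos_actionD delta A) bos_action_delta mulN1r.
Qed.

Lemma bos_action_path x t : bos_action (path_action x) t =
  bos_action A t + (sin x ^+ 2)%:C * bos_action B t.
Proof. exact: bos_actionD. Qed.

Lemma path_coercive x : coercive c (bos_action (path_action x)).
Proof.
move=> t; rewrite bos_action_path bos_action_B.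
have h0 : 0 <= sin x ^+ 2 by exact: sqr_ge0.
have h1 : sin x ^+ 2 <= 1.
  by rewrite -(cos2Dsin2 x) lerDr sqr_ge0.
move: (sin x ^+ 2) h0 h1 => g h0 h1.
rewrite complex_ReD complex_ReM complex_ReD complex_ReN /= mul0r subr0.
have := A_coercive t; have := sqnorm_ge0 t.
set S := sqnorm t; set q := complex.Re _ => S0 Sq.
have -> : q + g * (S - q) = (1 - g) * q + g * S by ring.
have e1 : (1 - g) * (c * S) <= (1 - g) * q by rewrite ler_wpM2l // subr_ge0.
have e2 : g * (c * S) <= g * S by rewrite ler_wpM2l // ler_piMl.
by apply: le_trans (lerD e1 e2); rewrite -mulrDl subrK mul1r.
Qed.

Let dsin2 (x : R) : R := 2 * sin x * cos x.

Lemma is_derive_sin2 (x : R) : is_derive x (1 : R) (fun y => sin y ^+ 2) (dsin2 x).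
Proof.
apply: (is_derive_eq (is_deriveM (is_derive_sin x) (is_derive_sin x))).
by rewrite /dsin2 /GRing.scale /=; ring.
Qed.

Lemma cderive_bos_integral x :
  cderive (fun y => bos_integral (path_action y) (fun=> 1)) x
    (- (dsin2 x)%:C * bos_integral (path_action x) (bos_action B)).
Proof.
have c20 : 0 < c / 2 by rewrite divr_gt0.
pose W y t : C := expC (- bos_action (path_action y) t).
have polyB : polyf (bos_action B) by exact: polyf_action.
have [K K0 BK] := polyf_subgauss polyB c20.
have -> : - (dsin2 x)%:C * bos_integral (path_action x) (bos_action B) =
    cintegral (fun t => - (dsin2 x)%:C * (bos_action B t * W x t)).
  rewrite (cintegralZ _ c20) //.
  by apply: polyf_gauss_bounded => //; [exact: polyf_action|exact: path_coercive].
apply: (@cderive_integral _ _ (c / 2) (4 * K) (fun y t => 1 * W y t)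
   (fun y t => - (dsin2 y)%:C * (bos_action B t * W y t)) x c20).
- move=> y; apply: (@polyf_gauss_bounded _ _ c (fun=> 1)) => //.
  + exact: polyf_cst.
  + exact: polyf_action.
  + exact: path_coercive.
- move=> y t; rewrite (_ : (fun y => 1 * W y t) = fun y => W y t); last first.
    by apply/funext => z; rewrite mul1r.
  rewrite mulrA; apply: cderive_expC.
  under eq_fun do rewrite bos_action_path.
  rewrite mulNr; apply: cderiveN.
  apply: cderive_eq (cderiveD (cderive_cst (bos_action A t) y)
    (cderiveM (cderive_real (is_derive_sin2 y)) (cderive_cst (bos_action B t) y))) _.
  by rewrite add0r mulr0 addr0.
- move=> y t; apply: le_trans (norm1M _ _) _.
  have d2 : norm1 (- (dsin2 y)%:C) <= 2.
    rewrite /norm1 /= oppr0 normr0 addr0 normrN /dsin2 !normrM.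
    rewrite ger0_norm // -mulrA ler_piMr // mulr_ile1 //.
      by rewrite ler_norml sin_geN1 sin_le1.
    by rewrite ler_norml cos_geN1 cos_le1.
  have BW : norm1 (bos_action B t * W y t) <=
      K * ngauss (- (c / 2)) t * (2 * ngauss c t).
    apply: le_trans (norm1M _ _) _; apply: ler_pM; rewrite ?norm1_ge0 //.
    apply: le_trans (norm1_expC _) _; rewrite ler_wpM2l // ler_expR complex_ReN lerN2.
    exact: path_coercive.
  apply: le_trans (ler_pM (norm1_ge0 _) (norm1_ge0 _) d2 BW) _.
  have -> : ngauss (c / 2) t = ngauss (- (c / 2)) t * ngauss c t.
    by rewrite /ngauss -expRD; congr expR; field.
  by rewrite le_eqVlt; apply/orP; left; apply/eqP; ring.
Qed.

(** Along the path the expectation of 1 has derivative 0 by expect_action0. *)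
Lemma expect_1 : expect s A (fun=> 1) = 1.
Proof.
pose Z x : C := (ferm_exp s (path_action x) * 1) top * bos_integral (path_action x) (fun=> 1).
have dZ x : cderive Z x 0.
  have dE := cderive_ferm_exp s A B (is_derive_sin2 x).
  have dE1 : cderive (fun y => (ferm_exp s (path_action y) * 1) top : C) x
      (- (dsin2 x)%:C * ((ferm_exp s (path_action x) * ferm_action s B) top : C)).
    under eq_fun do rewrite mulr1.
    by apply: cderive_eq (dE top) _; rewrite extZE.
  apply: cderive_eq (cderiveM dE1 (cderive_bos_integral x)) _.
  have := expect_action0 B c_gt0 (path_coercive x).
  set u := _ top; set v := bos_integral _ _; set w := _ top; set z := bos_integral _ _.
  move=> uvwz; transitivity (- (dsin2 x)%:C * (u * v + w * z)); first by ring.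
  by rewrite uvwz mulr0.
have Z0 : Z 0 = expect s A (fun=> 1).
  rewrite (expect_cst _ c_gt0 A_coercive) /Z.
  have -> // : path_action 0 = A.
  apply/funext => y; apply/funext => z.
  by rewrite /path_action sin0 expr0n /= mul0r addr0.
have Z1 : Z (pi / 2) = 1.
  have -> : Z (pi / 2) = (ferm_exp s delta * 1) top * bos_integral delta (fun=> 1).
    rewrite /Z; have -> // : path_action (pi / 2) = delta.
    apply/funext => y; apply/funext => z.
    by rewrite /path_action sin_pihalf expr1n mul1r addrC subrK.
  rewrite (ferm_exp_delta_top L hs) bos_integral_delta exprVn mulVf //.
  by rewrite expf_neq0 // piC_neq0.
by rewrite -Z0 -Z1; apply: cderive_0_cst.
Qed.

End Normalization.

(** * Coercivity *)

Section Coercivity.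
Variables (R : realType) (L : finType).
Local Open Scope classical_set_scope.
Local Notation C := R[i].
Local Notation re := (@complex.Re R).
Local Notation im := (@complex.Im R).
Local Notation point := (#|L|.*2.-tuple (measurableTypeR R)).
Implicit Types (t : point) (A : L -> L -> C).

Definition point_of_row n (v : 'rV[R]_n) : n.-tuple (measurableTypeR R) :=
  [tuple v ord0 i | i < n].

Lemma polyf_continuous n (f : n.-tuple (measurableTypeR R) -> C) : polyf f ->
  continuous (fun v => re (f (point_of_row v))) /\
  continuous (fun v => im (f (point_of_row v))).
Proof.
elim=> [z|i|{}f g _ [fr fi] _ [gr gi]|{}f g _ [fr fi] _ [gr gi]].
- by split; exact: cst_continuous.
- split; last exact: cst_continuous.
  by rewrite /= (_ : (fun v => _) = fun v : 'rV[R]_n => v ord0 i);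
    [exact: coord_continuous|apply/funext => v; rewrite tnth_mktuple].
- split=> v.
    rewrite (_ : (fun v => _) = (fun v => re (f (point_of_row v))) +
      (fun v => re (g (point_of_row v)))); first by apply: continuousD; [exact: fr|exact: gr].
    by apply/funext => w; rewrite complex_ReD.
  rewrite (_ : (fun v => _) = (fun v => im (f (point_of_row v))) +
    (fun v => im (g (point_of_row v)))); first by apply: continuousD; [exact: fi|exact: gi].
  by apply/funext => w; rewrite complex_ImD.
- split=> v.
    rewrite (_ : (fun v => _) =
      (fun v => re (f (point_of_row v))) \* (fun v => re (g (point_of_row v))) -
      (fun v => im (f (point_of_row v))) \* (fun v => im (g (point_of_row v)))).
      by apply: continuousB; apply: continuousM; [exact: fr|exact: gr|exact: fi|exact: gi].
    by apply/funext => w; rewrite complex_ReM.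
  rewrite (_ : (fun v => _) =
    (fun v => re (f (point_of_row v))) \* (fun v => im (g (point_of_row v))) +
    (fun v => im (f (point_of_row v))) \* (fun v => re (g (point_of_row v)))).
    by apply: continuousD; apply: continuousM; [exact: fr|exact: gi|exact: fi|exact: gr].
  by apply/funext => w; rewrite complex_ImM.
Qed.

Definition scale_point (k : R) t : point := [tuple k * tnth t i | i < #|L|.*2].

Lemma bos_action_scale A k t :
  bos_action A (scale_point k t) = (k ^+ 2)%:C * bos_action A t.
Proof.
rewrite /bos_action mulr_sumr; apply: eq_bigr => x _; rewrite mulr_sumr.
apply: eq_bigr => z _.
have -> : cphi x (scale_point k t) = k%:C * cphi x t.
  rewrite /cphi !tnth_mktuple; apply/eqP; rewrite eq_complex /=.
  by apply/andP; split; apply/eqP; ring.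
have -> : cphibar z (scale_point k t) = k%:C * cphibar z t.
  rewrite /cphibar !tnth_mktuple; apply/eqP; rewrite eq_complex /=.
  by apply/andP; split; apply/eqP; ring.
by rewrite rmorphXn /=; ring.
Qed.

Lemma sqnorm_scale k t : sqnorm (scale_point k t) = k ^+ 2 * sqnorm t.
Proof.
rewrite /sqnorm mulr_sumr; apply: eq_bigr => i _.
by rewrite tnth_mktuple exprMn.
Qed.

Lemma sum_sq_continuous n : continuous (fun v : 'rV[R]_n => \sum_i v ord0 i ^+ 2).
Proof.
pose f (t : n.-tuple (measurableTypeR R)) : C :=
  \sum_(i < n) (tnth t i : R)%:C * (tnth t i : R)%:C.
have pf : polyf f by apply: polyf_sum => i _; apply: polyfM; exact: polyf_coord.
have [+ _] := polyf_continuous pf; rewrite (_ : (fun v => _) = fun v : 'rV[R]_n =>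
  \sum_i v ord0 i ^+ 2) //; apply/funext => v.
rewrite /f -[RHS]/(re (\sum_i v ord0 i ^+ 2)%:C) rmorph_sum; congr re.
by apply: eq_bigr => i _; rewrite tnth_mktuple rmorphXn.
Qed.

Lemma sphere_compact n : compact [set v : 'rV[R]_n | \sum_i v ord0 i ^+ 2 = 1].
Proof.
have cube : compact [set v : 'rV[R]_n | forall i, `[(-1 : R), 1]%classic (v ord0 i)].
  by apply: (@rV_compact _ _ (fun=> `[(-1 : R), 1]%classic)) => _; exact: segment_compact.
apply: subclosed_compact cube _ => [|v /= v1 i].
  rewrite (_ : mkset _ = (fun v : 'rV[R]_n => \sum_i v ord0 i ^+ 2) @^-1` [set x | x = 1]) //.
  apply: closed_comp; last exact: closed_eq.
  move=> v _; exact: sum_sq_continuous.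
rewrite in_itv /= -ler_norml -(ler_pXn2r (_ : (0 < 2)%N)) ?nnegrE // expr1n.
rewrite real_normK ?num_real // -v1 (bigD1 i) //= lerDl.
by apply: sumr_ge0 => j _; exact: sqr_ge0.
Qed.

(** By homogeneity, it suffices to bound a positive form below on the unit
    sphere, which is compact. *)
Lemma coercive_of_positive A :
  (forall t x, cphi x t != 0 -> 0 < re (bos_action A t)) ->
  exists2 c, 0 < c <= 1 & coercive c (bos_action A).
Proof.
move=> A_pos.
have pos t : 0 < sqnorm t -> 0 < re (bos_action A t).
  move=> t0; have [[x xt]|all0] := pselect (exists x, cphi x t != 0).
    exact: A_pos xt.
  suff : sqnorm t = 0 by move=> s0; rewrite s0 ltxx in t0.
  have /(congr1 re) := bos_action_delta t; rewrite /= => <-.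
  rewrite /bos_action big1 // => x _; apply: big1 => z _.
  have -> : cphi x t = 0 by apply/eqP; apply: contra_notT all0 => xt; exists x.
  by rewrite mul0r mulr0.
have zero t : ~ (0 < sqnorm t) -> sqnorm t = 0 /\ re (bos_action A t) = 0.
  move=> /negP; rewrite -leNgt => t0; split.
    by apply/eqP; rewrite eq_le t0 sqnorm_ge0.
  rewrite /bos_action big1 // => x _; apply: big1 => z _.
  by rewrite (sqnorm_eq0 t0) mul0r mulr0.
have [m m0 mle] : exists2 m, 0 < m & forall t, sqnorm t = 1 -> m <= re (bos_action A t).
  have [S0|S0] := pselect ([set v : 'rV[R]_#|L|.*2 | \sum_i v ord0 i ^+ 2 = 1] !=set0).
    have [fc _] := polyf_continuous (polyf_action A).
    have [v0 v0S vmin] := EVT_min_rV S0 (@sphere_compact _) (continuous_subspaceT fc).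
    have rowE (v : 'rV[R]_#|L|.*2) : sqnorm (point_of_row v) = \sum_i v ord0 i ^+ 2.
      by apply: eq_bigr => i _; rewrite tnth_mktuple.
    exists (re (bos_action A (point_of_row v0))).
      by apply: pos; move: v0S; rewrite inE /= rowE => ->.
    move=> t t1; have <- : point_of_row (\row_i tnth t i) = t.
      by apply: eq_from_tnth => i; rewrite tnth_mktuple mxE.
    apply: vmin; rewrite inE /= -t1; apply: eq_bigr => i _.
    by rewrite mxE.
  exists 1 => // t t1; exfalso; apply: S0; exists (\row_i tnth t i) => /=.
  by rewrite -t1; apply: eq_bigr => i _; rewrite mxE.
exists (Num.min m 1); first by rewrite lt_min m0 ltr01 ge_min lexx orbT.
move=> t; have [t0|/zero[-> ->]] := pselect (0 < sqnorm t); last by rewrite mulr0.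
pose k := (Num.sqrt (sqnorm t))^-1.
have k2 : k ^+ 2 = (sqnorm t)^-1 by rewrite exprVn sqr_sqrtr ?sqnorm_ge0.
have := mle (scale_point k t).
rewrite sqnorm_scale k2 mulVf ?gt_eqF // => /(_ erefl).
rewrite bos_action_scale k2 complex_ReM /= mul0r subr0 mulrC ler_pdivlMr // => mS.
by apply: le_trans mS; rewrite ler_wpM2r ?sqnorm_ge0 // ge_min lexx.
Qed.

End Coercivity.

(** * Enumeration of the walks *)

Section WalkEnumeration.
Variable L : finType.
Implicit Types (x y z a b : L) (r w : seq L).

(** The interiors of walks, built from the first vertex on so as to match the
    recursion of the expectations; m bounds the length. *)
Fixpoint interiors m r : seq (seq L) :=
  if m is m'.+1 then
    [::] :: flatten [seq [seq y :: w | w <- interiors m' (rem y r)] | y <- r]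
  else [:: [::]].

Lemma mem_interiors m r w : uniq r -> (size r <= m)%N ->
  (w \in interiors m r) = uniq w && all (mem r) w.
Proof.
elim: m r w => [|m IHm] r w ur rm.
  have -> : r = [::] by apply: size0nil; apply/eqP; rewrite -leqn0.
  by rewrite inE; case: w => //= x w; rewrite andbF.
rewrite [interiors _ _]/= in_cons; case: w => [|y w] //=.
apply/flatten_mapP/idP => [[x xr /mapP[v + [-> ->]]]|].
  rewrite IHm ?rem_uniq //; last by rewrite size_rem // -ltnS prednK //; case: (r) xr.
  move=> /andP[uv /allP vr]; rewrite uv xr /= andbT; apply/andP; split.
    by apply/negP => /vr /=; rewrite mem_rem_uniq // inE eqxx.
  by apply/allP => z /vr /=; rewrite mem_rem_uniq // inE => /andP[].
move=> /andP[/andP[yw uw] /andP[yr /allP wr]]; exists y => //.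
apply/mapP; exists w => //.
rewrite IHm ?rem_uniq //; last by rewrite size_rem // -ltnS prednK //; case: (r) yr.
rewrite uw; apply/allP => z zw /=; rewrite mem_rem_uniq // inE.
rewrite (wr z zw : z \in r) andbT.
by apply: contraNneq yw => <-.
Qed.

Lemma uniq_interiors m r : uniq r -> uniq (interiors m r).
Proof.
elim: m r => // m IHm r ur /=; apply/andP; split.
  by apply/flatten_mapP => -[y _ /mapP[]].
suff H r' : {subset r' <= r} -> uniq r' ->
    uniq (flatten [seq [seq y :: w | w <- interiors m (rem y r)] | y <- r']) by exact: H.
elim: r' => //= y r' IHr yr /andP[yr' ur'].
rewrite cat_uniq IHr // ?andbT => [|z zr']; last by apply: yr; rewrite in_cons zr' orbT.
rewrite map_inj_uniq => [|u v [] //]; rewrite IHm ?rem_uniq //=.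
apply/hasPn => _ /flatten_mapP[x xr' /mapP[v _ ->]].
by apply/mapP => -[u _ [xy _]]; rewrite xy (negPf yr') in xr'.
Qed.

Section Weight.
Variables (K : comNzRingType) (M : 'M[K]_#|L|).

Lemma walk_weight1 a b : walk_weight M [:: a; b] = entry M a b.
Proof. by rewrite /walk_weight /= big_seq1. Qed.

Lemma walk_weight_cons a y w :
  walk_weight M (a :: y :: w) = entry M a y * walk_weight M (y :: w).
Proof. by rewrite /walk_weight /= big_cons. Qed.

(** Walks are decomposed by their first step, whose endpoint is no longer available
    to the rest of the walk. *)
Lemma walk_sum_rec (V : L -> seq L -> K) b :
  (forall a r, uniq r ->
    V a r = entry M a b + \sum_(y <- r) entry M a y * V y (rem y r)) ->
  forall a r, uniq r ->
  V a r = \sum_(w <- interiors (size r) r) walk_weight M (a :: rcons w b).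
Proof.
move=> Vrec a r ur; move mE : (size r) => m.
elim: m a r ur mE => [|m IHm] a r ur sr.
  by rewrite Vrec // (size0nil sr) big_nil addr0 big_seq1 walk_weight1.
rewrite Vrec //= big_cons walk_weight1; congr (_ + _).
rewrite big_flatten big_map big_seq [RHS]big_seq; apply: eq_bigr => y yr.
rewrite big_map (IHm y) ?rem_uniq ?size_rem ?sr // mulr_sumr.
by apply: eq_bigr => w _; rewrite walk_weight_cons.
Qed.

End Weight.

Lemma walks_interiors a b r : uniq r -> r =i [pred x | (x != a) && (x != b)] ->
  walks a b = [set` [seq a :: rcons w b | w <- interiors (size r) r]]%classic.
Proof.
move=> ur rE; apply/seteqP; split=> w /=.
  move=> [v [-> uv vr]]; apply/mapP; exists v => //.
  rewrite mem_interiors // uv; apply/allP => x /vr[xa xb] /=.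
  by rewrite rE inE xa.
move=> /mapP[v + ->]; rewrite mem_interiors // => /andP[uv /allP vr].
by exists v; split=> // x /vr /=; rewrite rE inE => /andP[].
Qed.

End WalkEnumeration.

(** * The integral of the statement *)

Section FormIntegral.
Variables (R : realType) (L : finType) (s : R[i]) (A : 'M[R[i]]_#|L|).
Local Notation C := R[i].
Local Notation point := (#|L|.*2.-tuple (measurableTypeR R)).
Local Notation ext := (extalg C #|L|.*2).
Local Notation top := [set: 'I_#|L|.*2]%SET.
Implicit Types (x y z a b : L) (t : point).

Lemma psi_grass x t : psi s x t = grass_psi s x.
Proof. by rewrite grass_psi.unlock. Qed.

Lemma psibar_grass x t : psibar s x t = grass_psibar s x.
Proof. by rewrite grass_psibar.unlock scaleNr. Qed.

Lemma phi_phibar x z t : (Defs.phi x * phibar z) t = (cphi x t * cphibar z t)%:A.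
Proof. by rewrite /GRing.mul /= -scalerAl mul1r scalerA. Qed.

Lemma psi_psibar_grass x z t : (psi s x * psibar s z) t = grass_psi s x * grass_psibar s z.
Proof. by rewrite -(psi_grass x t) -(psibar_grass z t). Qed.

Lemma tau_ctau x t : tau s x t = ctau s x t.
Proof. transitivity ((Defs.phi x * phibar x) t + (psi s x * psibar s x) t); first by [].
by rewrite (phi_phibar x x t) (psi_psibar_grass x x t). Qed.

Lemma form_action_split t :
  form_action s A t = (bos_action (entry A) t)%:A + ferm_action s (entry A).
Proof.
transitivity ((\sum_x \sum_y entry A x y *: (Defs.phi x * phibar y)) t +
  (\sum_x \sum_y entry A x y *: (psi s x * psibar s y)) t); first by [].
have sumE (F : L -> point -> ext) : (\sum_x F x) t = \sum_x F x t by rewrite fct_sumE.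
rewrite ferm_action.unlock /bos_action scaler_suml; congr (_ + _).
  apply: etrans (sumE _) _; apply: eq_bigr => x _.
  apply: etrans (sumE _) _; rewrite scaler_suml; apply: eq_bigr => z _.
  by rewrite -scalerA -(phi_phibar x z t).
apply: etrans (sumE _) _; apply: eq_bigr => x _.
apply: etrans (sumE _) _; apply: eq_bigr => z _.
by rewrite -(psi_psibar_grass x z t).
Qed.

(** The part of degree 0 of the action is phi A phibar, so the Taylor expansion is
    about that function and its increment is the fermionic action. *)
Lemma form_exp_action t : form_exp (- form_action s A) t =
  expC (- bos_action (entry A) t) *: ferm_exp s (entry A).
Proof.
have nil0 : ferm_action s (entry A) finset.set0 = 0.
  have := @degree_ge_actionX _ _ s 1 (entry A).
  by rewrite expr1 => -> //; rewrite finset.cards0.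
have FE : (- form_action s A) t = (- bos_action (entry A) t)%:A - ferm_action s (entry A).
  by rewrite [LHS]/GRing.opp /= form_action_split opprD scaleNr.
have F0 : (- form_action s A) t finset.set0 = - bos_action (entry A) t :> C.
  by rewrite FE extDE extNE nil0 oppr0 addr0 extZE ffunE eqxx mulr1.
by rewrite /form_exp F0 FE addrC addKr.
Qed.

Lemma form_integral_expect a b (P : pred L) :
  form_integral (form_exp (- form_action s A) * (phibar a * Defs.phi b) *
    \prod_(x | P x) (1 + tau s x)) =
  expect s (entry A) (fun t => (cphibar a t * cphi b t) *:
    tau_prod s [seq x <- index_enum L | P x] t).
Proof.
rewrite /form_integral /expect /bos_integral /cintegral.
set r := [seq x <- _ | _].
have e t : (form_exp (- form_action s A) * (phibar a * Defs.phi b) *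
    \prod_(x | P x) (1 + tau s x)) t top =
   (ferm_exp s (entry A) * ((cphibar a t * cphi b t) *: tau_prod s r t)) top *
   expC (- bos_action (entry A) t) :> C.
  have prodE : (\prod_(x | P x) (1 + tau s x)) t = tau_prod s r t.
    rewrite fct_prodE /tau_prod big_filter; apply: eq_bigr => x _.
    by rewrite -tau_ctau.
  have phiE : (phibar a * Defs.phi b) t = (cphibar a t * cphi b t)%:A.
    by rewrite /GRing.mul /= -scalerAl mul1r scalerA.
  transitivity ((form_exp (- form_action s A) t * (phibar a * Defs.phi b) t *
    (\prod_(x | P x) (1 + tau s x)) t) top); first by [].
  rewrite form_exp_action prodE phiE -!scalerAl extZE mulrC; congr (_ * _).
  by rewrite -!scalerAr -!scalerAl mulr1.
by congr (_ +i* _); apply: eq_Rintegral => t _; rewrite e.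
Qed.

Hypothesis A_unit : A \in unitmx.

Lemma entry_inverse x z :
  \sum_y entry (invmx A) x y * entry A y z = (x == z)%:R.
Proof.
have : (invmx A *m A) (enum_rank x) (enum_rank z) = (x == z)%:R.
  by rewrite mulVmx // mxE (inj_eq enum_rank_inj).
rewrite mxE => <-; rewrite (reindex (@enum_rank L)) //=.
exact/onW_bij/enum_rank_bij.
Qed.

(** The Hermitian part of A at phi is that of its inverse C at phi A. *)
Lemma action_positive : positive_hermitian_part (invmx A) ->
  forall t x, cphi x t != 0 -> 0 < complex.Re (bos_action (entry A) t).
Proof.
move=> C_pos t x tx0.
pose v : 'rV[C]_#|L| := \row_j cphi (enum_val j) t.
have v0 : v != 0.
  apply: contra_neq tx0 => v0; have := congr1 (fun w : 'rV_#|L| => w 0 (enum_rank x)) v0.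
  by rewrite !mxE enum_rankK.
pose w := v *m A; have wC : w *m invmx A = v by rewrite mulmxK.
have vE i : v 0 i = \sum_j w 0 j * invmx A j i.
  by have /(congr1 (fun u : 'rV_#|L| => u 0 i)) := wC; rewrite mxE.
have w0 : w != 0.
  by apply: contra_neq v0 => w0; rewrite -wC w0 mul0mx.
pose X := \sum_i w 0 i * (v 0 i)^*.
have qX : bos_action (entry A) t = X.
  rewrite /bos_action exchange_big /= (reindex (@enum_val L predT)) /=; last first.
    exact/onW_bij/enum_val_bij.
  apply: eq_bigr => j _; rewrite /w mxE mulr_suml.
  rewrite (reindex (@enum_val L predT)) /=; last exact/onW_bij/enum_val_bij.
  apply: eq_bigr => i _; rewrite !mxE /entry !enum_valK mulrA mulrC.
  by rewrite [in RHS]mulrC (mulrC (A i j)).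
have := C_pos w w0.
have -> : \sum_i \sum_j w 0 i * (invmx A i j + (invmx A j i)^*) * (w 0 j)^* = X^* + X.
  have e1 : \sum_i \sum_j w 0 i * invmx A i j * (w 0 j)^* = X^*.
    rewrite exchange_big rmorph_sum; apply: eq_bigr => j _ /=.
    by rewrite -mulr_suml rmorphM /= conjCK mulrC vE.
  have e2 : \sum_i \sum_j w 0 i * (invmx A j i)^* * (w 0 j)^* = X.
    apply: eq_bigr => i _; rewrite vE rmorph_sum mulr_sumr.
    by apply: eq_bigr => j _; rewrite rmorphM /= -mulrA; congr (_ * _); rewrite mulrC.
  rewrite -{2}e2 -e1 -big_split; apply: eq_bigr => i _; rewrite -big_split.
  by apply: eq_bigr => j _; rewrite mulrDr mulrDl.
rewrite qX ltcE /= => /andP[_].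
case: (X) => p q /=. lra.
Qed.

End FormIntegral.

Theorem theorem6p11 (R : realType) (L : finType) (A : 'M[R[i]]_#|L|) (a b : L)
    (s : R[i]) (hs : s ^+ 2 = 2 * pi%:C * 'i)
    (A_unit : A \in unitmx) (C_pos : positive_hermitian_part (invmx A)) :
  \sum_(w \in walks a b) walk_weight (invmx A) w =
  form_integral (form_exp (- form_action s A) * (phibar a * phi b) *
    \prod_(x : L | (x != a) && (x != b)) (1 + tau s x)).
Proof.
have [c /andP[c0 c1] cA] := coercive_of_positive (action_positive A_unit C_pos).
have s0 := root_neq0 hs; have CA := entry_inverse A_unit.
rewrite form_integral_expect; set r := [seq x <- _ | _].
have ur : uniq r by rewrite filter_uniq // index_enum_uniq.
have rE : r =i [pred x | (x != a) && (x != b)].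
  by move=> x; rewrite mem_filter mem_index_enum andbT.
rewrite (walks_interiors ur rE) -fsbig_seq; last first.
  by rewrite map_inj_uniq ?uniq_interiors // => u v [] /rcons_inj[].
rewrite big_map.
pose V y q := expect s (entry A) (fun t => (cphibar y t * cphi b t) *: tau_prod s q t).
apply/esym; apply: (@walk_sum_rec _ _ (invmx A) V b _ a r ur) => y q uq.
rewrite /V (expect_pair_phi s c0 cA CA b y uq).
by rewrite (expect_tau_prod s0 c0 cA CA uq) (expect_1 hs c0 c1 cA) mulr1.
Qed.
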